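(* Let $G := M_{24}$ be the Mathieu group of degree $24$. Then $G$ contains a subgroup $G_1 \cong PSL(2,23)$ and a subgroup $G_2 \cong (\mathbb{Z}/2\mathbb{Z})^4 \rtimes A_7$, where $A_7$ acts on $(\mathbb{Z}/2\mathbb{Z})^4$ via the embedding $A_7 \subset A_8 \cong SL(4,2) = \mathrm{Aut}((\mathbb{Z}/2\mathbb{Z})^4)$, such that: $G_1$ and $G_2$ are perfect; $G_1$ and $G_2$ are self normalizing in $G$ (i.e. $N_G(G_i)=G_i$ for $i=1,2$); and $G = G_1G_2$ is an exact factorization (i.e. $G=G_1G_2$ and $G_1\cap G_2=1$). In particular, the bicrossproduct Hopf algebra $H(G,G_1,G_2)$ over $\mathbb{C}$ is biperfect.
   Context: A finite group is called perfect if it has no non-trivial $1$-dimensional representations over $\mathbb{C}$ (equivalently, it equals its commutator subgroup). A finite-dimensional Hopf algebra $H$ over $\mathbb{C}$ is called perfect if every $1$-dimensional $H$-module is trivial (i.e. given by the counit); $H$ is called biperfect if both $H$ and its dual $H^*$ are perfect. Let $G$ be a finite group with subgroups $G_1,G_2$. We say $G=G_1G_2$ is an exact factorization if $G=G_1G_2$ and $G_1\cap G_2=1$. In this case $G_1$ is identified as a set with $G/G_2$ and $G_2$ with $G/G_1$ (via $g \mapsto$ its left coset), so left translation makes $G_2$ a $G_1$-set and $G_1$ a $G_2$-set: for $a\in G_1$, $x\in G_2$, $a\cdot x$ is the unique element of $G_2$ with $axG_1=(a\cdot x)G_1$, and $x\cdot a$ is the unique element of $G_1$ with $xaG_2=(x\cdot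 a)G_2$. The bicrossproduct Hopf algebra $H(G,G_1,G_2)$ is the vector space $\mathbb{C}[G_2]^*\otimes\mathbb{C}[G_1]$ with its unique semisimple Hopf algebra structure (Kac, Takeuchi) whose product is $$(\varphi\otimes a)(\psi\otimes b)=\varphi(a\cdot\psi)\otimes ab,\qquad \varphi,\psi\in\mathbb{C}[G_2]^*,\ a,b\in G_1,$$ where $\mathbb{C}[G_2]^*$ is the algebra of functions on $G_2$ with pointwise product and $(a\cdot\psi)(x)=\psi(a^{-1}\cdot x)$, and whose coproduct is $$(\Delta(\varphi\otimes a))(b\otimes c)=\varphi(bc)\,a\otimes (b^{-1}\cdot a),\qquad \varphi\in\mathbb{C}[G_2]^*,\ a\in G_1,\ b,c\in G_2,$$ where $H\otimes H$ (with $H=\mathbb{C}[G_2]^*\otimes\mathbb{C}[G_1]$) is identified with $\mathrm{Hom}_{\mathbb{C}}(\mathbb{C}[G_2]\otimes\mathbb{C}[G_2],\mathbb{C}[G_1]\otimes\mathbb{C}[G_1])$ in the usual way. *)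

(* Defs.v *)
From HB Require Import structures.
From mathcomp Require Import all_boot all_order all_fingroup all_algebra.
From mathcomp Require Import all_solvable all_field all_character.
From mathcomp Require Import reals complex.

Set Implicit Arguments.
Unset Strict Implicit.
Unset Printing Implicit Defensive.

Import GroupScope GRing.Theory.
Local Open Scope ring_scope.

Notation tensor V W := 'M_(\dim (fullv : {vspace V}), \dim (fullv : {vspace W})).

Section Tensor.
Variable k : fieldType.

Implicit Types V W U : vectType k.

(* A tensor is represented by its matrix of coordinates on the library bases
   of V and W. *)
Definition tens V W (v : V) (w : W) : 'M[k]_(\dim {:V}, \dim {:W}) :=
  \matrix_(i, j) (coord (vbasis {:V}) i v * coord (vbasis {:W}) j w).

(* The linear map on tensors induced by a bilinear map B (see tlift_tens), so
   that tlift (fun x y => E) (comul h) below is Sweedler's sum of the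
   E(h_(1), h_(2)). *)
Definition tlift V W (U : lmodType k) (B : V -> W -> U) (t : tensor V W) : U :=
  \sum_i \sum_j t i j *: B (vbasis {:V})`_i (vbasis {:W})`_j.

Definition bilin V W (U : lmodType k) (B : V -> W -> U) :=
  (forall w, linear (B^~ w)) /\ (forall v, linear (B v)).

Lemma linear_sumZ (V U : lmodType k) (f : V -> U) (I : finType)
    (c : I -> k) (F : I -> V) :
  linear f -> f (\sum_i c i *: F i) = \sum_i c i *: f (F i).
Proof.
move=> lf; pose g := GRing.isLinear.Build _ _ _ _ f lf.
pose h : {linear V -> U} := HB.pack f g.
by rewrite -[f]/(h : V -> U) linear_sum; apply: eq_bigr => i _; rewrite linearZ.
Qed.

Lemma linear_sum_raw (V U : lmodType k) (f : V -> U) (I : finType)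
    (F : I -> V) :
  linear f -> f (\sum_i F i) = \sum_i f (F i).
Proof.
move=> lf; have := linear_sumZ (fun _ => 1) F lf.
by under eq_bigr do rewrite scale1r; under [in RHS]eq_bigr do rewrite scale1r.
Qed.

Lemma linear_fZ (V U : lmodType k) (f : V -> U) c v :
  linear f -> f (c *: v) = c *: f v.
Proof.
move=> lf; pose g := GRing.isLinear.Build _ _ _ _ f lf.
pose h : {linear V -> U} := HB.pack f g.
by rewrite -[f]/(h : V -> U) linearZ.
Qed.

Lemma linear_comp_lin (V W U : lmodType k) (f : W -> U) (g : V -> W) :
  linear f -> linear g -> linear (f \o g).
Proof. by move=> lf lg a u v /=; rewrite lg lf. Qed.

Lemma vbasis_exp V (v : V) :
  v = \sum_i coord (vbasis {:V}) i v *: (vbasis {:V})`_i.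
Proof. exact: coord_vbasis (memvf v). Qed.

Lemma bilin_tens V W : bilin (@tens V W).
Proof.
split=> [w|v] a x y; apply/matrixP=> i j; rewrite !mxE linearP /=.
  by rewrite mulrDl mulrA.
by rewrite mulrDr mulrCA.
Qed.

Lemma tlift_tens V W (U : lmodType k) (B : V -> W -> U) v w :
  bilin B -> tlift B (tens v w) = B v w.
Proof.
case=> Bl Br; rewrite [in RHS](vbasis_exp v) (linear_sumZ _ _ (Bl _)).
apply: eq_bigr => i _; rewrite [in RHS](vbasis_exp w) (linear_sumZ _ _ (Br _)).
by rewrite scaler_sumr; apply: eq_bigr => j _; rewrite mxE scalerA.
Qed.

Lemma linear_tlift V W (U : lmodType k) (B : V -> W -> U) : linear (tlift B).
Proof.
move=> a s t; rewrite /tlift scaler_sumr -big_split; apply: eq_bigr => i _ /=.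
rewrite scaler_sumr -big_split; apply: eq_bigr => j _ /=.
by rewrite !mxE scalerDl scalerA.
Qed.

Lemma linear_tlift_par V W (X U : lmodType k) (B : X -> V -> W -> U) t :
  (forall v w, linear (fun x => B x v w)) -> linear (fun x => tlift (B x) t).
Proof.
move=> lB a x y; rewrite /tlift scaler_sumr -big_split; apply: eq_bigr => i _ /=.
rewrite scaler_sumr -big_split; apply: eq_bigr => j _ /=.
by rewrite lB scalerDr !scalerA mulrC.
Qed.

Lemma tlift_comp V W (U U' : lmodType k) (f : U -> U') (B : V -> W -> U) t :
  linear f -> f (tlift B t) = tlift (fun v w => f (B v w)) t.
Proof.
move=> lf; rewrite /tlift !pair_big /=.
exact: (@linear_sumZ _ _ f _ (fun p => t p.1 p.2)
         (fun p => B (vbasis {:V})`_p.1 (vbasis {:W})`_p.2) lf).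
Qed.

Lemma eq_tlift V W (U : lmodType k) (B B' : V -> W -> U) t :
  (forall v w, B v w = B' v w) -> tlift B t = tlift B' t.
Proof.
by move=> eqB; apply: eq_bigr => i _; apply: eq_bigr => j _; rewrite eqB.
Qed.

Lemma coord_vb V (i j : 'I_(\dim {:V})) :
  coord (vbasis {:V}) i (vbasis {:V})`_j = (i == j)%:R.
Proof. by rewrite eq_sym coord_free // (basis_free (vbasisP _)). Qed.

Lemma tlift_id V W (t : tensor V W) : tlift (@tens V W) t = t.
Proof.
apply/matrixP=> p q; rewrite /tlift summxE (bigD1 p) //= [X in _ + X]big1.
  rewrite addr0 summxE (bigD1 q) //= [X in _ + X]big1 => [|j nj].
    by rewrite addr0 !mxE !coord_vb !eqxx !mulr1.
  by rewrite !mxE !coord_vb (eq_sym q) (negPf nj) !mulr0.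
move=> i ni; rewrite summxE big1 // => j _.
by rewrite !mxE !coord_vb (eq_sym p) (negPf ni) mul0r mulr0.
Qed.

Lemma tens_ext V W (U : lmodType k) (f g : tensor V W -> U) :
  linear f -> linear g -> (forall v w, f (tens v w) = g (tens v w)) ->
  forall t, f t = g t.
Proof.
by move=> lf lg e t; rewrite -(tlift_id t) !tlift_comp //; apply: eq_tlift.
Qed.

Lemma tlift_pair V W (U : lmodType k) (B : V -> W -> U) t :
  tlift B t = \sum_p t p.1 p.2 *: B (vbasis {:V})`_p.1 (vbasis {:W})`_p.2.
Proof. by rewrite /tlift pair_big. Qed.

Lemma tlift_exch V W V' W' (U : lmodType k)
    (B : V -> W -> V' -> W' -> U) t t' :
  tlift (fun v w => tlift (B v w) t') t =
  tlift (fun v' w' => tlift (fun v w => B v w v' w') t) t'.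
Proof.
rewrite !tlift_pair.
under eq_bigr do rewrite tlift_pair scaler_sumr.
under [RHS]eq_bigr do rewrite tlift_pair scaler_sumr.
rewrite exchange_big; apply: eq_bigr => p _; apply: eq_bigr => q _ /=.
by rewrite !scalerA mulrC.
Qed.

End Tensor.
Arguments tens {k V W}.
Notation "v ⊗ w" := (tens v w) (at level 39, left associativity) : ring_scope.

HB.mixin Record isHopfAlgebra (k : fieldType) A of Falgebra k A := {
  comul : A -> tensor A A;
  counit : A -> k;
  antipode : A -> A;
  comul_linear : linear comul;
  counit_linear : linear (counit : A -> k^o);
  antipode_linear : linear antipode;
  comulA : forall h : A,
    tlift (fun x y => tlift (fun x1 x2 => x1 ⊗ (x2 ⊗ y)) (comul x)) (comul h)
    = tlift (fun x y => x ⊗ comul y) (comul h);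
  counitl : forall h : A, tlift (fun x y => counit x *: y) (comul h) = h;
  counitr : forall h : A, tlift (fun x y => counit y *: x) (comul h) = h;
  comul1 : comul 1 = 1 ⊗ 1;
  comulM : forall g h : A, comul (g * h) =
    tlift (fun x y => tlift (fun x' y' => (x * x') ⊗ (y * y')) (comul h))
      (comul g);
  counit1 : counit 1 = 1;
  counitM : forall g h : A, counit (g * h) = counit g * counit h;
  antipodel : forall h : A,
    tlift (fun x y => antipode x * y) (comul h) = (counit h)%:A;
  antipoder : forall h : A,
    tlift (fun x y => x * antipode y) (comul h) = (counit h)%:A
}.

#[short(type="hopfType")]
HB.structure Definition HopfAlgebra (k : fieldType) :=
  {A of Falgebra k A & isHopfAlgebra k A}.

(* The dual Hopf algebra: every structure map is the transpose of one of H. *)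
Definition hdual (k : fieldType) (H : hopfType k) : Type := 'Hom(H, k^o).
HB.instance Definition _ k (H : hopfType k) :=
  Vector.copy (hdual H) 'Hom(H, k^o).
HB.instance Definition _ k (H : hopfType k) := Equality.on (hdual H).

Section Dual.
Variables (k : fieldType) (H : hopfType k).
Local Notation D := (hdual H).
Local Notation n := (\dim (fullv : {vspace H})).
Local Notation b := (vbasis (fullv : {vspace H})).
Implicit Types (f g l : D) (x y h : H).

Definition hmk (F : H -> k) : D := linfun (F : H -> k^o).
Definition hval (f : D) : H -> k := fun_of_lfun f.
Local Coercion hval : hdual >-> Funclass.

Lemma hmkE F : linear (F : H -> k^o) -> forall x, hmk F x = F x.
Proof.
move=> lF x; pose m := GRing.isLinear.Build _ _ _ _ _ lF.
pose F' : {linear H -> k^o} := HB.pack (F : H -> k^o) m.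
exact: (lfunE F').
Qed.

Lemma hdual_ext f g : (forall x, f x = g x) -> f = g.
Proof. by move=> e; apply/lfunP. Qed.

Lemma hvalP f a x y : f (a *: x + y) = a * f x + f y.
Proof. by rewrite /hval linearP. Qed.

Lemma hval_linear f : linear (f : H -> k^o).
Proof. by move=> a x y; apply: hvalP. Qed.

Lemma hdlinE a f g x : hval (a *: f + g) x = a * f x + g x.
Proof. by rewrite /hval !lfunE /= !lfunE. Qed.

Lemma ev_linear x : linear ((fun f => f x) : D -> k^o).
Proof. by move=> a f g; apply: hdlinE. Qed.

Definition dual_mul f g : D :=
  hmk (fun h => tlift (fun x y => f x * g y : k^o) (comul h)).
Definition dual_one : D := hmk counit.

Lemma dual_mulE f g h :
  dual_mul f g h = tlift (fun x y => f x * g y : k^o) (comul h).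
Proof.
apply: hmkE; apply: (linear_comp_lin (f := tlift _)); last exact: comul_linear.
exact: linear_tlift.
Qed.

Lemma dual_oneE h : dual_one h = counit h.
Proof. by apply: hmkE; apply: counit_linear. Qed.

Lemma bilin_hh f g : bilin (fun x y => f x * g y : k^o).
Proof.
split=> z a x y; rewrite hvalP; first by rewrite mulrDl -mulrA.
by rewrite mulrDr mulrCA.
Qed.

Lemma eq_tliftk (V W : vectType k) (B B' : V -> W -> k) (t : tensor V W) :
  (forall (v : V) (w : W), B v w = B' v w) ->
  tlift (B : V -> W -> k^o) t = tlift (B' : V -> W -> k^o) t.
Proof. exact: (@eq_tlift k V W k^o). Qed.

Lemma dual_mulA : associative dual_mul.
Proof.
move=> f g l; apply: hdual_ext => h; rewrite !dual_mulE.
pose F (s : tensor H H) : k^o := tlift (fun y z => g y * l z : k^o) s.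
pose B x (s : tensor H H) : k^o := f x * F s.
have bB : bilin B.
  split=> z a x y; rewrite /B; first by rewrite hvalP mulrDl -mulrA.
  by rewrite /F linear_tlift mulrDr mulrCA.
have := congr1 (tlift B) (comulA h); rewrite !tlift_comp; try exact: linear_tlift.
move=> e; transitivity (tlift (fun x y => B x (comul y)) (comul h)).
  by apply: eq_tliftk => x y; rewrite /B dual_mulE.
rewrite (eq_tliftk (B' := fun x y => tlift B (x ⊗ comul y))); last first.
  by move=> x y; rewrite tlift_tens.
rewrite -e; apply: eq_tliftk => x y; rewrite tlift_comp; last exact: linear_tlift.
rewrite dual_mulE [RHS]mulrC -[RHS]/(l y *: (_ : k^o)).
rewrite (tlift_comp (U' := k^o) (f := fun z : k^o => l y *: z)); last first.
  by move=> a z t; rewrite scalerDr !scalerA mulrC.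
apply: eq_tliftk => z t; rewrite tlift_tens // /B /F tlift_tens; last exact: bilin_hh.
by rewrite mulrA mulrC.
Qed.

Lemma dual_mul1f : left_id dual_one dual_mul.
Proof.
move=> f; apply: hdual_ext => h; rewrite dual_mulE -[in RHS](counitl h).
rewrite (tlift_comp (U' := k^o) _ _ (hval_linear f)); apply: eq_tliftk => x y.
by rewrite dual_oneE /hval linearZ.
Qed.

Lemma dual_mulf1 : right_id dual_one dual_mul.
Proof.
move=> f; apply: hdual_ext => h; rewrite dual_mulE -[in RHS](counitr h).
rewrite (tlift_comp (U' := k^o) _ _ (hval_linear f)); apply: eq_tliftk => x y.
by rewrite dual_oneE /hval linearZ mulrC.
Qed.

Lemma dual_mulP_l a f f' g :
  dual_mul (a *: f + f') g = a *: dual_mul f g + dual_mul f' g.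
Proof.
apply: hdual_ext => h; rewrite hdlinE !dual_mulE.
pose B (u : D) x y : k^o := hval u x * g y.
apply: (@linear_tlift_par k H H D k^o B (comul h)) => y z c f1 f2.
by rewrite /B hdlinE mulrDl -mulrA.
Qed.
Lemma dual_mulP_r a f g g' :
  dual_mul f (a *: g + g') = a *: dual_mul f g + dual_mul f g'.
Proof.
apply: hdual_ext => h; rewrite hdlinE !dual_mulE.
pose B (u : D) x y : k^o := f x * hval u y.
apply: (@linear_tlift_par k H H D k^o B (comul h)) => y z c f1 f2.
by rewrite /B hdlinE mulrDr mulrCA.
Qed.

Lemma dual_mulDl : left_distributive dual_mul +%R.
Proof. by move=> f g l; have:= dual_mulP_l 1 f g l; rewrite !scale1r. Qed.
Lemma dual_mulDr : right_distributive dual_mul +%R.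
Proof. by move=> f g l; have:= dual_mulP_r 1 f g l; rewrite !scale1r. Qed.
Lemma dual_one_neq0 : dual_one != 0.
Proof.
apply/eqP=> /(congr1 (fun f : D => f 1)); rewrite dual_oneE counit1 => /eqP.
by rewrite /hval lfunE /= oner_eq0.
Qed.

HB.instance Definition _ := GRing.Zmodule_isNzRing.Build D
  dual_mulA dual_mul1f dual_mulf1 dual_mulDl dual_mulDr dual_one_neq0.

Lemma dual_scalerAl a f g : a *: (f * g) = a *: f * g.
Proof. by have:= dual_mulP_l a f 0 g; rewrite !addr0 -[dual_mul 0 g]/(0 * g) mul0r addr0. Qed.
Lemma dual_scalerAr a f g : a *: (f * g) = f * (a *: g).
Proof. by have:= dual_mulP_r a f g 0; rewrite !addr0 -[dual_mul f 0]/(f * 0) mulr0 addr0. Qed.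

HB.instance Definition _ := GRing.Lmodule_isLalgebra.Build k D dual_scalerAl.
HB.instance Definition _ := GRing.Lalgebra_isAlgebra.Build k D dual_scalerAr.
HB.instance Definition _ := Algebra_isFalgebra.Build k D.

Let tk (V W : vectType k) (B : V -> W -> k) (t : tensor V W) : k :=
  tlift (B : V -> W -> k^o) t.

Let eq_tk (V W : vectType k) (B B' : V -> W -> k) (t : tensor V W) :
  (forall (v : V) (w : W), B v w = B' v w) -> tk B t = tk B' t.
Proof. exact: (@eq_tlift k V W k^o). Qed.

Let tk_mull (V W : vectType k) (B : V -> W -> k) (t : tensor V W) c :
  c * tk B t = tk (fun (v : V) (w : W) => c * B v w) t.
Proof.
rewrite /tk -[LHS]/(c *: (_ : k^o)).
rewrite (tlift_comp (U' := k^o) (f := fun z : k^o => c *: z)) //.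
by move=> a z s; rewrite scalerDr !scalerA mulrC.
Qed.

Let tk_exch (V W V' W' : vectType k) (B : V -> W -> V' -> W' -> k)
    (t : tensor V W) (t' : tensor V' W') :
  tk (fun (v : V) (w : W) => tk (B v w) t') t =
  tk (fun (v' : V') (w' : W') => tk (fun (v : V) (w : W) => B v w v' w') t) t'.
Proof. exact: (@tlift_exch k V W V' W' k^o). Qed.

Let tk_exch4 (V1 W1 V2 W2 V3 W3 V4 W4 : vectType k)
    (B : V1 -> W1 -> V2 -> W2 -> V3 -> W3 -> V4 -> W4 -> k)
    (t1 : tensor V1 W1) (t2 : tensor V2 W2)
    (t3 : tensor V3 W3) (t4 : tensor V4 W4) :
  tk (fun p1 q1 => tk (fun p2 q2 => tk (fun p3 q3 => tk (fun p4 q4 =>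
    B p1 q1 p2 q2 p3 q3 p4 q4) t4) t3) t2) t1 =
  tk (fun p3 q3 => tk (fun p4 q4 => tk (fun p1 q1 => tk (fun p2 q2 =>
    B p1 q1 p2 q2 p3 q3 p4 q4) t2) t1) t4) t3.
Proof.
transitivity (tk (fun p1 q1 => tk (fun p3 q3 => tk (fun p4 q4 =>
    tk (fun p2 q2 => B p1 q1 p2 q2 p3 q3 p4 q4) t2) t4) t3) t1).
  apply: eq_tk => p1 q1; rewrite tk_exch; apply: eq_tk => p3 q3.
  exact: tk_exch.
by rewrite tk_exch; apply: eq_tk => p3 q3; apply: tk_exch.
Qed.

Definition hcb i : D := hmk (coord b i).

Lemma hcbE i x : hcb i x = coord b i x.
Proof. by apply: hmkE => a y z; rewrite linearP. Qed.

Lemma hval_sum f (I : finType) (c : I -> k) (F : I -> H) :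
  f (\sum_i c i *: F i) = \sum_i c i * f (F i).
Proof. exact: (linear_sumZ c F (hval_linear f)). Qed.

Lemma hdual_sum (I : finType) (c : I -> k) (F : I -> D) x :
  hval (\sum_i c i *: F i) x = \sum_i c i * F i x.
Proof. exact: (linear_sumZ c F (ev_linear x)). Qed.

Lemma hdual_exp f : f = \sum_(i < n) f b`_i *: hcb i.
Proof.
apply: hdual_ext => x; rewrite hdual_sum {1}(vbasis_exp x) hval_sum.
by apply: eq_bigr => i _; rewrite hcbE mulrC.
Qed.

Definition contract (W : vectType k) x (t : tensor D W) : W :=
  tlift (fun (f : D) w => f x *: w) t.

Lemma linear_contract (W : vectType k) x : linear (@contract W x).
Proof. exact: linear_tlift. Qed.

Lemma contract_tens (W : vectType k) x f (w : W) :
  contract x (f ⊗ w) = f x *: w.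
Proof.
apply: tlift_tens; split=> [s|g] a u v.
  by rewrite hdlinE scalerDl scalerA.
by rewrite scalerDr !scalerA mulrC.
Qed.

Lemma contract_ext (W : vectType k) (t t' : tensor D W) :
  (forall x, contract x t = contract x t') -> t = t'.
Proof.
pose R (s : tensor D W) : tensor D W := \sum_(i < n) hcb i ⊗ contract b`_i s.
have [tl tr] := @bilin_tens k D W.
have RE s : R s = s.
  move: s; apply: tens_ext => [||f w].
  - move=> a s s'; rewrite /R scaler_sumr -big_split; apply: eq_bigr => i _ /=.
    by rewrite linear_contract tr.
  - by [].
  rewrite [in RHS](hdual_exp f) (linear_sumZ _ _ (tl w)).
  apply: eq_bigr => i _; rewrite contract_tens.
  by rewrite (linear_fZ _ _ (tr _)).
by move=> e; rewrite -[t]RE -[t']RE; apply: eq_bigr => i _; rewrite e.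
Qed.

(* By dual_comulE below, this is the tensor whose value at (x, y) is f (x * y). *)
Definition dual_comul f : tensor D D :=
  \sum_(i < n) \sum_(j < n) f (b`_i * b`_j) *: (hcb i ⊗ hcb j).
Definition dual_counit f : k := f 1.
Definition dual_antipode f : D := hmk (fun h => f (antipode h)).

Lemma dual_antipodeE f h : dual_antipode f h = f (antipode h).
Proof. by apply: hmkE => a x y; rewrite antipode_linear hvalP. Qed.

Lemma dual_comul_linear : linear dual_comul.
Proof.
move=> a f g; rewrite /dual_comul scaler_sumr -big_split; apply: eq_bigr => i _ /=.
rewrite scaler_sumr -big_split; apply: eq_bigr => j _ /=.
by rewrite hdlinE scalerDl scalerA.
Qed.

Lemma dual_counit_linear : linear (dual_counit : D -> k^o).
Proof. exact: ev_linear. Qed.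

Lemma dual_antipode_linear : linear dual_antipode.
Proof.
by move=> a f g; apply: hdual_ext => x; rewrite hdlinE !dual_antipodeE hdlinE.
Qed.

Lemma bilin_ev x y : bilin (fun f g : D => f x * g y : k^o).
Proof.
split=> l a f g; rewrite hdlinE; first by rewrite mulrDl -mulrA.
by rewrite mulrDr mulrCA.
Qed.

Lemma dual_comulE f x y : tk (fun u v : D => u x * v y) (dual_comul f) = f (x * y).
Proof.
rewrite /tk /dual_comul.
have lt := linear_tlift (fun u v : D => u x * v y : k^o).
rewrite (linear_sum_raw _ lt) [in RHS](vbasis_exp x) mulr_suml.
under [in RHS]eq_bigr do rewrite -scalerAl.
rewrite hval_sum; apply: eq_bigr => i _.
rewrite (linear_sumZ _ _ lt) [in RHS](vbasis_exp y) mulr_sumr.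
under [in RHS]eq_bigr do rewrite -scalerAr.
rewrite hval_sum mulr_sumr; apply: eq_bigr => j _.
rewrite tlift_tens ?hcbE; last exact: bilin_ev.
by rewrite [RHS]mulrA [RHS]mulrC.
Qed.

Lemma hval_tliftl (V W : vectType k) (B : V -> W -> H) t f :
  f (tlift B t) = tk (fun v w => f (B v w)) t.
Proof. exact: (tlift_comp (U' := k^o) B t (hval_linear f)). Qed.

Lemma hvalZ c f x : f (c *: x) = c * f x.
Proof. exact: (linear_fZ c x (hval_linear f)). Qed.

Lemma hval_tlift (V W : vectType k) (B : V -> W -> D) t x :
  hval (tlift B t) x = tk (fun v w => hval (B v w) x) t.
Proof. exact: (tlift_comp (U' := k^o) B t (ev_linear x)). Qed.

Lemma scale_ev c f x : hval (c *: f) x = c * f x.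
Proof. exact: (linear_fZ c f (ev_linear x)). Qed.

Lemma ev_contract x y (t : tensor D D) :
  hval (contract x t) y = tk (fun u v : D => u x * v y) t.
Proof.
rewrite /contract hval_tlift.
by apply: eq_tk => u v; rewrite scale_ev.
Qed.

Lemma tensorDD_ext (t t' : tensor D D) :
  (forall x y, tk (fun u v : D => u x * v y) t = tk (fun u v : D => u x * v y) t') ->
  t = t'.
Proof.
by move=> e; apply: contract_ext => x; apply: hdual_ext => y; rewrite !ev_contract.
Qed.

Lemma dual_comulA f :
  tlift (fun u v => tlift (fun u1 u2 => u1 ⊗ (u2 ⊗ v)) (dual_comul u)) (dual_comul f)
  = tlift (fun u v => u ⊗ dual_comul v) (dual_comul f).
Proof.
apply: contract_ext => x; apply: contract_ext => y; apply: hdual_ext => z.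
have l3 : linear (fun t : tensor D (tensor D D) =>
    hval (contract y (contract x t)) z : k^o).
  by move=> a s t; rewrite !linear_contract hdlinE.
have lT (V W : vectType k) (B : V -> W -> tensor D (tensor D D)) t :
    hval (contract y (contract x (tlift B t))) z =
    tk (fun v w => hval (contract y (contract x (B v w))) z) t.
  exact: (tlift_comp (U' := k^o) B t l3).
rewrite !lT.
transitivity (f (x * y * z)).
  rewrite -dual_comulE; apply: eq_tk => u v.
  rewrite lT -dual_comulE mulrC tk_mull.
  apply: eq_tk => u1 u2; rewrite contract_tens.
  rewrite (linear_fZ _ _ (linear_contract _)) contract_tens !scale_ev.
  by rewrite mulrA mulrC.
rewrite -mulrA -dual_comulE; apply: eq_tk => u v.
rewrite contract_tens (linear_fZ _ _ (linear_contract _)) scale_ev.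
by rewrite ev_contract dual_comulE.
Qed.

Lemma dual_counitl f : tlift (fun u v => dual_counit u *: v) (dual_comul f) = f.
Proof.
apply: hdual_ext => y; rewrite hval_tlift.
transitivity (f (1 * y)); last by rewrite mul1r.
by rewrite -dual_comulE; apply: eq_tk => u v; rewrite scale_ev.
Qed.

Lemma dual_counitr f : tlift (fun u v => dual_counit v *: u) (dual_comul f) = f.
Proof.
apply: hdual_ext => y; rewrite hval_tlift.
transitivity (f (y * 1)); last by rewrite mulr1.
by rewrite -dual_comulE; apply: eq_tk => u v; rewrite scale_ev mulrC.
Qed.

Lemma hval1 x : hval (1 : D) x = counit x.
Proof. exact: dual_oneE. Qed.

Lemma hvalM f g x :
  hval (f * g) x = tk (fun x y => f x * g y) (comul x).
Proof. exact: dual_mulE. Qed.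

Lemma tk_tens x y f g : tk (fun u v : D => u x * v y) (f ⊗ g) = f x * g y.
Proof. by rewrite /tk tlift_tens //; apply: bilin_ev. Qed.

Lemma dual_comul1 : dual_comul 1 = 1 ⊗ 1.
Proof.
apply: tensorDD_ext => x y.
by rewrite dual_comulE tk_tens !hval1 counitM.
Qed.

Lemma dual_comulM f g : dual_comul (f * g) =
    tlift (fun u v => tlift (fun u' v' => (u * u') ⊗ (v * v')) (dual_comul g))
      (dual_comul f).
Proof.
apply: tensorDD_ext => x y.
have lt := linear_tlift (fun u v : D => u x * v y : k^o).
rewrite dual_comulE hvalM comulM [RHS](tlift_comp (U' := k^o) _ _ lt).
transitivity (tk (fun u v : D => tk (fun u' v' : D =>
   tk (fun x1 x2 => tk (fun y1 y2 => u x1 * v y1 * (u' x2 * v' y2)) (comul y))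
    (comul x)) (dual_comul g)) (dual_comul f)); last first.
  apply: eq_tk => u v; rewrite [RHS](tlift_comp (U' := k^o) _ _ lt).
  apply: eq_tk => u' v'; rewrite -[RHS]/(tk _ _) tk_tens !hvalM mulrC tk_mull.
  apply: eq_tk => x1 x2; rewrite mulrC tk_mull.
  by apply: eq_tk => y1 y2; rewrite mulrACA.
transitivity (tk (fun x1 x2 => tk (fun y1 y2 => tk (fun u v : D =>
   tk (fun u' v' : D => u x1 * v y1 * (u' x2 * v' y2)) (dual_comul g))
   (dual_comul f)) (comul y)) (comul x)); last by rewrite tk_exch4.
rewrite /tk (tlift_comp (U' := k^o) _ _ (linear_tlift _)); apply: eq_tk => x1 x2.
rewrite /tk (tlift_comp (U' := k^o) _ _ (linear_tlift _)); apply: eq_tk => y1 y2.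
rewrite tlift_tens; last exact: bilin_hh.
rewrite -!dual_comulE mulrC tk_mull; apply: eq_tk => u v.
by rewrite mulrC tk_mull; apply: eq_tk.
Qed.

Lemma dual_counit1 : dual_counit 1 = 1.
Proof. by rewrite /dual_counit hval1 counit1. Qed.

Lemma dual_counitM f g : dual_counit (f * g) = dual_counit f * dual_counit g.
Proof.
by rewrite /dual_counit hvalM comul1 /tk tlift_tens //; apply: bilin_hh.
Qed.


Lemma dual_antipodel f :
  tlift (fun u v => dual_antipode u * v) (dual_comul f) = (dual_counit f)%:A.
Proof.
apply: hdual_ext => x; rewrite hval_tlift scale_ev hval1 mulrC -hvalZ -antipodel.
rewrite hval_tliftl.
transitivity (tk (fun u v : D => tk (fun y z => u (antipode y) * v z) (comul x))
  (dual_comul f)).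
  apply: eq_tk => u v; rewrite hvalM; apply: eq_tk => y z.
  by rewrite dual_antipodeE.
by rewrite tk_exch; apply: eq_tk => y z; rewrite dual_comulE.
Qed.

Lemma dual_antipoder f :
  tlift (fun u v => u * dual_antipode v) (dual_comul f) = (dual_counit f)%:A.
Proof.
apply: hdual_ext => x; rewrite hval_tlift scale_ev hval1 mulrC -hvalZ -antipoder.
rewrite hval_tliftl.
transitivity (tk (fun u v : D => tk (fun y z => u y * v (antipode z)) (comul x))
  (dual_comul f)).
  apply: eq_tk => u v; rewrite hvalM; apply: eq_tk => y z.
  by rewrite dual_antipodeE.
by rewrite tk_exch; apply: eq_tk => y z; rewrite dual_comulE.
Qed.

HB.instance Definition _ := isHopfAlgebra.Build k D
  dual_comul_linear dual_counit_linear dual_antipode_linear dual_comulA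
  dual_counitl dual_counitr dual_comul1 dual_comulM dual_counit1 dual_counitM
  dual_antipodel dual_antipoder.

End Dual.

Definition exact_factorization (gT : finGroupType) (G G1 G2 : {group gT}) :=
  (G1 * G2)%g = G /\ (G1 :&: G2)%g = 1%g.

Lemma exact_factorizationC (gT : finGroupType) (G G1 G2 : {group gT}) :
  exact_factorization G G1 G2 -> exact_factorization G G2 G1.
Proof.
case=> defG ti; split; last by rewrite setIC.
have /comm_group_setP cG : group_set (G1 * G2)%g by rewrite defG groupP.
by rewrite -cG.
Qed.

Section CosetAction.
Variables (gT : finGroupType) (A B : {group gT}).
Implicit Types (a : subg_of A) (x y : subg_of B).

(* The element y of B such that a x A = y A, computed from the factorization
   a x = y r with r in A; see coset_actP. *)
Definition coset_act a x : subg_of B :=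
  subg B (divgr B A (sgval a * sgval x)%g).

End CosetAction.
Notation "a ▹ x" := (coset_act a x) (at level 38, right associativity) : group_scope.

Section CosetActionTheory.
Variables (gT : finGroupType) (G A B : {group gT}).
Hypothesis e : exact_factorization G A B.
Implicit Types (a b r : subg_of A) (x y : subg_of B).
Local Open Scope group_scope.

Lemma coset_act_uniq a x y r :
  sgval a * sgval x = sgval y * sgval r -> a ▹ x = y.
Proof.
case: e => _ ti eq; rewrite /coset_act eq divgrMid ?subgP ?sgvalK //.
by rewrite setIC.
Qed.

Lemma coset_act_eq a x :
  sgval a * sgval x = sgval (a ▹ x) * sgval (x^-1 ▹ a^-1)^-1.
Proof.
have [eG ti] := e; have [eG' ti'] := exact_factorizationC e.
have BAm : sgval a * sgval x \in B * A.
  by rewrite eG' -eG mem_mulg ?subgP.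
have By := mem_divgr BAm; have Ar := mem_remgr BAm.
rewrite /coset_act subgK //; rewrite {1}(divgr_eq B A (sgval a * _)).
congr (_ * _); rewrite /coset_act -[sgval a^-1]/((sgval a)^-1) -[sgval x^-1]/((sgval x)^-1).
rewrite -invMg {2}(divgr_eq B A (sgval a * _)) invMg divgrMid ?groupV //.
rewrite -[sgval _^-1]/((sgval _)^-1) subgK ?groupV ?invgK //.
Qed.

Lemma coset_actP a x y :
  (sgval a * sgval x) *: A = sgval y *: A <-> y = a ▹ x.
Proof.
rewrite coset_act_eq lcosetM lcoset_id ?subgP //; split=> [|->//].
move/lcoset_eqP/lcosetP=> [r Ar eqr]; symmetry.
apply: (@coset_act_uniq _ _ _ (subg A r * (x^-1 ▹ a^-1)^-1)).
rewrite coset_act_eq eqr -mulgA; congr (_ * _).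
by rewrite -[sgval (_ * _)]/(sgval _ * sgval _) subgK.
Qed.

Lemma coset_act1 x : (1 : subg_of A) ▹ x = x.
Proof. by apply: (@coset_act_uniq _ _ _ 1); rewrite mulg1 mul1g. Qed.

Lemma coset_actx1 a : a ▹ (1 : subg_of B) = 1.
Proof. by apply: (@coset_act_uniq _ _ _ a); rewrite mulg1 mul1g. Qed.

Lemma coset_actM a b x : (a * b) ▹ x = a ▹ b ▹ x.
Proof.
apply: (@coset_act_uniq _ _ _
  (((b ▹ x)^-1 ▹ a^-1)^-1 * (x^-1 ▹ b^-1)^-1)).
rewrite -[sgval (a * b)]/(sgval a * sgval b) -mulgA coset_act_eq mulgA.
by rewrite coset_act_eq -mulgA.
Qed.

Lemma coset_actK a : cancel (coset_act a : subg_of B -> _) (coset_act a^-1).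
Proof. by move=> x; rewrite -coset_actM mulVg coset_act1. Qed.

Lemma coset_actVK a : cancel (coset_act a^-1 : subg_of B -> _) (coset_act a).
Proof. by move=> x; rewrite -coset_actM mulgV coset_act1. Qed.

Lemma coset_act_mul a x y :
  a ▹ (x * y) = (a ▹ x) * ((x^-1 ▹ a^-1)^-1 ▹ y).
Proof.
set c := (_ ▹ _)^-1.
apply: (@coset_act_uniq _ _ _ (y^-1 ▹ c^-1)^-1).
rewrite -[sgval (x * y)]/(sgval x * sgval y) mulgA coset_act_eq -/c -mulgA.
by rewrite coset_act_eq mulgA.
Qed.

End CosetActionTheory.

(* C[G2]^* (x) C[G1] as the space of functions G2 -> C[G1]: h (x, a) is the
   coefficient of a in h x. *)
Definition bicrossproduct (k : fieldType) (gT : finGroupType)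
    (G G1 G2 : {group gT}) (e : exact_factorization G G1 G2) : Type :=
  {ffun subg_of G2 * subg_of G1 -> k^o}.

HB.instance Definition _ k gT G G1 G2 e := 
  Vector.copy (@bicrossproduct k gT G G1 G2 e)
    {ffun subg_of G2 * subg_of G1 -> k^o}.

Section Bicrossproduct.
Variables (k : fieldType) (gT : finGroupType) (G G1 G2 : {group gT}).
Variable e : exact_factorization G G1 G2.
Local Notation P := (subg_of G1).
Local Notation Q := (subg_of G2).
Local Notation BH := (bicrossproduct k e).
Implicit Types (a b c : P) (x y z : Q) (g h : BH).

Let e' : exact_factorization G G2 G1 := exact_factorizationC e.

Definition bmk (F : Q * P -> k) : BH := finfun (F : Q * P -> k^o).
Definition bval (h : BH) : Q * P -> k := fun_of_fin h.
Local Coercion bval : bicrossproduct >-> Funclass.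

Lemma bmkE F p : bmk F p = F p. Proof. exact: ffunE. Qed.
Lemma bext g h : (forall p, g p = h p) -> g = h.
Proof. by move=> eq; apply/ffunP. Qed.
Lemma bval_lin t g h p : bval (t *: g + h) p = t * g p + h p.
Proof. by rewrite /bval !ffunE. Qed.
Lemma bval_linear p : linear (fun h => h p : k^o).
Proof. by move=> t g h; apply: bval_lin. Qed.
Lemma bvalZ t g p : bval (t *: g) p = t * g p.
Proof. exact: (linear_fZ t g (bval_linear p)). Qed.
Lemma bval_sum (I : finType) (F : I -> BH) p :
  bval (\sum_i F i) p = \sum_i F i p.
Proof. exact: (linear_sum_raw F (bval_linear p)). Qed.
Lemma bval_sumZ (I : finType) (t : I -> k) (F : I -> BH) p :
  bval (\sum_i t i *: F i) p = \sum_i t i * F i p.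
Proof. exact: (linear_sumZ t F (bval_linear p)). Qed.

(* The pure tensor phi (x) a. *)
Definition bx_tens (phi : Q -> k) a : BH := bmk (fun p => phi p.1 *+ (p.2 == a)).
Definition delta_fun x : Q -> k := fun y => (y == x)%:R.

(* Bilinear and linear extensions of the product and coproduct formulas on pure
   tensors, which are bx_mul_tens and bx_comul_tens below. *)
Definition bx_mul g h : BH :=
  \sum_a \sum_b bx_tens (fun x => g (x, a) * h ((a^-1 ▹ x)%g, b)) (a * b)%g.
Definition bx_one : BH := bx_tens (fun _ => 1) 1%g.
Definition bx_comul h : tensor BH BH :=
  \sum_x \sum_y \sum_a h ((x * y)%g, a)
    *: (bx_tens (delta_fun x) a ⊗ bx_tens (delta_fun y) (x^-1 ▹ a)%g).
Definition bx_counit h : k := \sum_a h (1%g, a).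
Definition bx_antipode h : BH :=
  \sum_x \sum_a h (x, a) *: bx_tens (delta_fun (a^-1 ▹ x)^-1%g) (x^-1 ▹ a)^-1%g.

Lemma bx_mulE g h x c :
  bx_mul g h (x, c) = \sum_a g (x, a) * h ((a^-1 ▹ x)%g, (a^-1 * c)%g).
Proof.
rewrite bval_sum; apply: eq_bigr => a _; rewrite bval_sum.
rewrite (bigD1 (a^-1 * c)%g) //= big1 => [|b nb]; rewrite bmkE /=.
  by rewrite mulKVg eqxx addr0.
by rewrite eq_sym (can2_eq (mulKg a) (mulKVg a)) (negPf nb).
Qed.

Lemma bx_oneE x a : bx_one (x, a) = (a == 1%g)%:R.
Proof. by rewrite bmkE. Qed.

Lemma bx_mulA : associative bx_mul.
Proof.
move=> f g h; apply: bext => -[x c]; rewrite !bx_mulE.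
under eq_bigr do rewrite bx_mulE mulr_sumr.
under [RHS]eq_bigr do rewrite bx_mulE mulr_suml.
rewrite [RHS]exchange_big /=; apply: eq_bigr => a _.
rewrite [RHS](reindex_inj (mulgI a)); apply: eq_bigr => b _.
by rewrite mulrA mulKg invMg (coset_actM e) mulgA.
Qed.

Lemma bx_mul1h : left_id bx_one bx_mul.
Proof.
move=> h; apply: bext => -[x c]; rewrite bx_mulE (bigD1 1%g) //= big1.
  by rewrite bx_oneE eqxx invg1 (coset_act1 e) !mul1g mul1r addr0.
by move=> a na; rewrite bx_oneE (negPf na) mul0r.
Qed.

Lemma bmulh1 : right_id bx_one bx_mul.
Proof.
move=> h; apply: bext => -[x c]; rewrite bx_mulE (bigD1 c) //= big1.
  by rewrite bx_oneE mulVg eqxx mulr1 addr0.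
by move=> a na; rewrite bx_oneE -eq_mulVg1 (negPf na) mulr0.
Qed.

Lemma bx_mulPl t f g h : bx_mul (t *: f + g) h = t *: bx_mul f h + bx_mul g h.
Proof.
apply: bext => -[x c]; rewrite bval_lin !bx_mulE mulr_sumr -big_split.
by apply: eq_bigr => a _ /=; rewrite bval_lin mulrDl mulrA.
Qed.
Lemma bx_mulPr t f g h : bx_mul h (t *: f + g) = t *: bx_mul h f + bx_mul h g.
Proof.
apply: bext => -[x c]; rewrite bval_lin !bx_mulE mulr_sumr -big_split.
by apply: eq_bigr => a _ /=; rewrite bval_lin mulrDr mulrCA.
Qed.
Lemma bx_mulDl : left_distributive bx_mul +%R.
Proof. by move=> f g l; have:= bx_mulPl 1 f g l; rewrite !scale1r. Qed.
Lemma bx_mulDr : right_distributive bx_mul +%R.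
Proof. by move=> f g l; have:= bx_mulPr 1 g l f; rewrite !scale1r. Qed.
Lemma bx_one_neq0 : bx_one != 0.
Proof.
apply/eqP=> /(congr1 (fun h : BH => h (1%g, 1%g))); rewrite bx_oneE eqxx => /eqP.
by rewrite /bval ffunE oner_eq0.
Qed.

HB.instance Definition _ := GRing.Zmodule_isNzRing.Build BH
  bx_mulA bx_mul1h bmulh1 bx_mulDl bx_mulDr bx_one_neq0.

Lemma bscalerAl t f g : t *: (f * g) = t *: f * g.
Proof.
have:= bx_mulPl t f 0 g.
by rewrite !addr0 -[bx_mul 0 g]/(0 * g) mul0r addr0.
Qed.
Lemma bscalerAr t f g : t *: (f * g) = f * (t *: g).
Proof.
have:= bx_mulPr t g 0 f.
by rewrite !addr0 -[bx_mul f 0]/(f * 0) mulr0 addr0.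
Qed.

HB.instance Definition _ := GRing.Lmodule_isLalgebra.Build k BH bscalerAl.
HB.instance Definition _ := GRing.Lalgebra_isAlgebra.Build k BH bscalerAr.
HB.instance Definition _ := Algebra_isFalgebra.Build k BH.

Definition bx_basis x a : BH := bx_tens (delta_fun x) a.

Lemma bx_basisE x a y b : bx_basis x a (y, b) = ((y == x) && (b == a))%:R.
Proof. by rewrite bmkE /= /delta_fun; case: eqP => _ //; case: eqP. Qed.

Lemma b_exp h : h = \sum_x \sum_a h (x, a) *: bx_basis x a.
Proof.
apply: bext => -[y b]; rewrite bval_sum (bigD1 y) //= [X in _ + X]big1.
  rewrite addr0 bval_sumZ (bigD1 b) //= bx_basisE !eqxx mulr1 big1 ?addr0 // => a na.
  by rewrite bx_basisE eqxx eq_sym (negPf na) mulr0.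
move=> x nx; rewrite bval_sumZ big1 // => a _.
by rewrite bx_basisE eq_sym (negPf nx) mulr0.
Qed.

Lemma b_ext (U : lmodType k) (f g : BH -> U) : linear f -> linear g ->
  (forall x a, f (bx_basis x a) = g (bx_basis x a)) -> forall h, f h = g h.
Proof.
move=> lf lg eq h; rewrite (b_exp h) (linear_sum_raw _ lf) (linear_sum_raw _ lg).
apply: eq_bigr => x _; rewrite (linear_sumZ _ _ lf) (linear_sumZ _ _ lg).
by apply: eq_bigr => a _; rewrite eq.
Qed.

Lemma bx_basis_mul x a y b :
  bx_basis x a * bx_basis y b = (y == a^-1 ▹ x)%g%:R *: bx_basis x (a * b)%g.
Proof.
apply: bext => -[z c]; rewrite bvalZ [LHS]bx_mulE (bigD1 a) //= big1.
  rewrite addr0 !bx_basisE eqxx andbT -!natrM !mulnb.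
  rewrite [(a^-1 * c == b)%g]eq_sym -(can2_eq (mulKg a) (mulKVg a)).
  rewrite [(c == _)%g]eq_sym; case: (z =P x) => [->|_]; last by rewrite andbF.
  by rewrite [y == _]eq_sym.
by move=> a' na; rewrite bx_basisE (negPf na) andbF mul0r.
Qed.

Lemma bx_comul_linear : linear bx_comul.
Proof.
move=> t g h; rewrite /bx_comul.
do 3!(rewrite scaler_sumr -big_split; apply: eq_bigr => ? _ /=).
by rewrite bval_lin scalerDl scalerA.
Qed.

Lemma bx_counit_linear : linear (bx_counit : BH -> k^o).
Proof.
move=> t g h; rewrite /bx_counit scaler_sumr -big_split; apply: eq_bigr => a _.
exact: bval_lin.
Qed.

Lemma bx_antipode_linear : linear bx_antipode.
Proof.
move=> t g h; rewrite /bx_antipode.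
do 2!(rewrite scaler_sumr -big_split; apply: eq_bigr => ? _ /=).
by rewrite bval_lin scalerDl scalerA.
Qed.

Lemma bx_comulE x a :
  bx_comul (bx_basis x a) = \sum_y bx_basis y a ⊗ bx_basis (y^-1 * x)%g (y^-1 ▹ a)%g.
Proof.
apply: eq_bigr => y _; rewrite (bigD1 (y^-1 * x)%g) //= [X in _ + X]big1.
  rewrite addr0 (bigD1 a) //= big1 => [|b nb].
    by rewrite addr0 bx_basisE mulKVg !eqxx scale1r.
  by rewrite bx_basisE (negPf nb) andbF scale0r.
move=> z nz; rewrite big1 // => b _; rewrite bx_basisE (can2_eq (mulKg y) (mulKVg y)).
by rewrite (negPf nz) scale0r.
Qed.

Lemma bx_counitE x a : bx_counit (bx_basis x a) = (x == 1%g)%:R.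
Proof.
rewrite /bx_counit (bigD1 a) //= big1 => [|b nb].
  by rewrite addr0 bx_basisE eqxx andbT eq_sym.
by rewrite bx_basisE (negPf nb) andbF.
Qed.

Lemma bx_antipodeE x a :
  bx_antipode (bx_basis x a) = bx_basis (a^-1 ▹ x)^-1%g (x^-1 ▹ a)^-1%g.
Proof.
rewrite /bx_antipode (bigD1 x) //= [X in _ + X]big1 => [|y ny].
  rewrite addr0 (bigD1 a) //= big1 => [|b nb].
    by rewrite addr0 bx_basisE !eqxx scale1r.
  by rewrite bx_basisE (negPf nb) andbF scale0r.
by rewrite big1 // => b _; rewrite bx_basisE (negPf ny) scale0r.
Qed.

Lemma tlift_bcomul (U : lmodType k) (B : BH -> BH -> U) x a : bilin B ->
  tlift B (bx_comul (bx_basis x a)) =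
    \sum_y B (bx_basis y a) (bx_basis (y^-1 * x)%g (y^-1 ▹ a)%g).
Proof.
move=> bB; rewrite bx_comulE (linear_sum_raw _ (linear_tlift _)).
by apply: eq_bigr => y _; rewrite tlift_tens.
Qed.

Lemma linear_tlift_bcomul (U : lmodType k) (B : BH -> BH -> U) :
  linear (fun h => tlift B (bx_comul h)).
Proof. exact: (linear_comp_lin (linear_tlift B) bx_comul_linear). Qed.

Lemma bilin_bmul : bilin (fun g h : BH => g * h).
Proof. by split=> h t f g; [exact: bx_mulPl | exact: bx_mulPr]. Qed.

Lemma bx_comulA h :
  tlift (fun u v => tlift (fun u1 u2 => u1 ⊗ (u2 ⊗ v)) (bx_comul u)) (bx_comul h)
  = tlift (fun u v => u ⊗ bx_comul v) (bx_comul h).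
Proof.
have [tl tr] := @bilin_tens k BH (tensor BH BH).
have [tl' tr'] := @bilin_tens k BH BH.
have bB1 (v : BH) : bilin (fun u1 u2 : BH => u1 ⊗ (u2 ⊗ v)).
  by split=> w s p q; [exact: (tl (w ⊗ v) s p q) | rewrite tl' tr].
move: h; apply: b_ext => [||x a]; try exact: linear_tlift_bcomul.
rewrite tlift_bcomul; last first.
  split=> w; first exact: linear_tlift_bcomul.
  by apply: linear_tlift_par => p q s f g; rewrite tr' tr.
rewrite tlift_bcomul; last first.
  by split=> w s p q; [exact: (tl (bx_comul w) s p q) | rewrite bx_comul_linear tr].
under eq_bigr do rewrite tlift_bcomul //.
rewrite exchange_big; apply: eq_bigr => y _ /=.
rewrite bx_comulE (linear_sum_raw _ (tr _)) (reindex_inj (mulgI y)) /=.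
by apply: eq_bigr => z _; rewrite mulKg invMg mulgA (coset_actM e').
Qed.

Lemma bx_counitl h : tlift (fun u v => bx_counit u *: v) (bx_comul h) = h.
Proof.
move: h; apply: b_ext => [||x a]; [exact: linear_tlift_bcomul | by [] |].
rewrite tlift_bcomul; last first.
  split=> w s p q; last by rewrite scalerDr !scalerA mulrC.
  by rewrite bx_counit_linear scalerDl scalerA.
rewrite (bigD1 1%g) //= big1 => [|y ny].
  by rewrite addr0 bx_counitE eqxx scale1r invg1 mul1g (coset_act1 e').
by rewrite bx_counitE (negPf ny) scale0r.
Qed.

Lemma bx_counitr h : tlift (fun u v => bx_counit v *: u) (bx_comul h) = h.
Proof.
move: h; apply: b_ext => [||x a]; [exact: linear_tlift_bcomul | by [] |].
rewrite tlift_bcomul; last first.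
  split=> w s p q; first by rewrite scalerDr !scalerA mulrC.
  by rewrite bx_counit_linear scalerDl scalerA.
rewrite (bigD1 x) //= big1 => [|y ny].
  by rewrite addr0 bx_counitE mulVg eqxx scale1r.
by rewrite bx_counitE -eq_mulVg1 (negPf ny) scale0r.
Qed.

Lemma b1E : 1 = \sum_x bx_basis x 1%g.
Proof.
apply: bext => -[y b]; rewrite bval_sum [LHS]bx_oneE (bigD1 y) //= big1.
  by rewrite addr0 bx_basisE eqxx.
by move=> x nx; rewrite bx_basisE eq_sym (negPf nx).
Qed.

Lemma bx_comul1 : bx_comul 1 = 1 ⊗ 1.
Proof.
have [tl' tr'] := @bilin_tens k BH BH.
rewrite {1}b1E (linear_sum_raw _ bx_comul_linear).
under eq_bigr do rewrite bx_comulE.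
rewrite exchange_big [in RHS]b1E (linear_sum_raw _ (tl' _)).
apply: eq_bigr => y _ /=; rewrite (linear_sum_raw _ (tr' _)).
rewrite (reindex_inj (mulgI y)) /=; apply: eq_bigr => z _.
by rewrite mulKg (coset_actx1 e').
Qed.

Lemma bval1 x a : bval 1 (x, a) = (a == 1%g)%:R.
Proof. exact: bx_oneE. Qed.

Lemma bx_counit1 : bx_counit 1 = 1.
Proof.
rewrite /bx_counit (bigD1 1%g) //= big1 => [|a na]; rewrite bval1.
  by rewrite eqxx addr0.
by rewrite (negPf na).
Qed.

Lemma bx_counitM g h : bx_counit (g * h) = bx_counit g * bx_counit h.
Proof.
move: g; apply: (@b_ext k^o (fun g => bx_counit (g * h)) (fun g => bx_counit g * bx_counit h)).
- by move=> t f g; rewrite [(_ + _) * h]bx_mulPl bx_counit_linear.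
- by move=> t f g; rewrite bx_counit_linear -[t *: (bx_counit f : k^o)]/(t * bx_counit f) mulrDl -mulrA.
move=> x a; move: h; apply: (@b_ext k^o (fun h => bx_counit (bx_basis x a * h)) (fun h => bx_counit (bx_basis x a) * bx_counit h)).
- by move=> t f g; rewrite [bx_basis x a * _]bx_mulPr bx_counit_linear.
- by move=> t f g; rewrite bx_counit_linear -[t *: (bx_counit f : k^o)]/(t * bx_counit f) mulrDr mulrCA.
move=> y b; rewrite bx_basis_mul (linear_fZ _ _ bx_counit_linear) !bx_counitE.
rewrite -[LHS]/(_ * _) -!natrM !mulnb andbC; case: eqP => // ->.
by rewrite (coset_actx1 e).
Qed.

Lemma bx_comulM g h : bx_comul (g * h) =
    tlift (fun u v => tlift (fun u' v' => (u * u') ⊗ (v * v')) (bx_comul h))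
      (bx_comul g).
Proof.
have [tl tr] := @bilin_tens k BH BH.
have [ml mr] := bilin_bmul.
have bB (u v : BH) : bilin (fun u' v' : BH => (u * u') ⊗ (v * v')).
  by split=> w s p q; rewrite mr ?tl ?tr.
have bC h' : bilin (fun u v =>
    tlift (fun u' v' => (u * u') ⊗ (v * v')) (bx_comul h')).
  split=> w; apply: (linear_tlift_par (B := fun _ _ _ => _ ⊗ _)) => p q s u v;
    by rewrite ml ?tl ?tr.
move: g; apply: b_ext; last 1 first.
- move=> x a; move: h; apply: b_ext; last 1 first.
  + move=> y b; rewrite bx_basis_mul (linear_fZ _ _ bx_comul_linear) bx_comulE.
    rewrite tlift_bcomul //.
    under [RHS]eq_bigr do rewrite tlift_bcomul //.
    rewrite scaler_sumr; apply: eq_bigr => c _.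
    rewrite (bigD1 (a^-1 ▹ c)%g) //= [X in _ + X]big1 => [|d nd]; last first.
      by rewrite bx_basis_mul (linear_fZ _ _ (tl _)) (negPf nd) scale0r.
    rewrite addr0 !bx_basis_mul eqxx scale1r (linear_fZ _ _ (tr _)).
    rewrite (coset_act_mul e') invgK; congr ((nat_of_bool _)%:R *: _).
    rewrite -{1}[x](mulKVg c) (coset_act_mul e) invgK.
    by rewrite [RHS](can2_eq (mulKVg _) (mulKg _)).
  + by move=> t f g; rewrite [_ * _]mr bx_comul_linear.
  + by apply: linear_tlift_par => u v; apply: linear_tlift_bcomul.
- by move=> t f g; rewrite [_ * h]ml bx_comul_linear.
- exact: linear_tlift_bcomul.
Qed.

Lemma bx_antipodel h :
  tlift (fun u v => bx_antipode u * v) (bx_comul h) = (bx_counit h)%:A.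
Proof.
have [ml mr] := bilin_bmul.
have bB : bilin (fun u v : BH => bx_antipode u * v).
  by split=> w s p q; [rewrite bx_antipode_linear ml | rewrite mr].
move: h; apply: b_ext => [||x a]; first exact: linear_tlift_bcomul.
  by move=> s p q; rewrite bx_counit_linear scalerDl -scalerA.
rewrite tlift_bcomul // bx_counitE.
have actV (b : P) (y : Q) : ((y^-1 ▹ b) ▹ (b^-1 ▹ y)^-1 = y^-1)%g.
  apply: (@coset_act_uniq _ _ _ _ e _ _ _ b).
  by have := coset_act_eq e' y^-1%g b; rewrite invgK => ->.
transitivity (\sum_y (x == 1%g)%:R *: bx_basis (a^-1 ▹ y)^-1%g 1%g).
  apply: eq_bigr => y _; rewrite bx_antipodeE bx_basis_mul invgK actV mulVg.
  by rewrite -[X in _ == X]mulg1 (can_eq (mulKg _)).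
rewrite -scaler_sumr b1E; congr (_ *: _); symmetry.
apply: (reindex_inj (h := fun y => (a^-1 ▹ y)^-1%g)).
by move=> y z /invg_inj /(can_inj (coset_actK e a^-1%g)).
Qed.

Lemma bx_antipoder h :
  tlift (fun u v => u * bx_antipode v) (bx_comul h) = (bx_counit h)%:A.
Proof.
have [ml mr] := bilin_bmul.
have bB : bilin (fun u v : BH => u * bx_antipode v).
  by split=> w s p q; [rewrite ml | rewrite bx_antipode_linear mr].
move: h; apply: b_ext => [||x a]; first exact: linear_tlift_bcomul.
  by move=> s p q; rewrite bx_counit_linear scalerDl -scalerA.
rewrite tlift_bcomul // bx_counitE.
transitivity (\sum_y (x == 1%g)%:R *: bx_basis y 1%g); last by rewrite -scaler_sumr b1E.
apply: eq_bigr => y _; rewrite bx_antipodeE bx_basis_mul.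
rewrite invMg invgK (coset_actM e') (coset_actVK e').
rewrite [_ == (a^-1 ▹ y)%g]eq_sym eq_mulgV1 invgK.
have := coset_act_mul e a^-1%g y (y^-1 * x)%g; rewrite mulKVg invgK => <-.
rewrite -[X in _ == X](coset_actx1 e a^-1%g) (can_eq (coset_actK e a^-1%g)).
case: eqP => [->|_]; last by rewrite !scale0r.
by rewrite invg1 (coset_act1 e') mulgV.
Qed.

HB.instance Definition _ := isHopfAlgebra.Build k BH
  bx_comul_linear bx_counit_linear bx_antipode_linear bx_comulA bx_counitl bx_counitr
  bx_comul1 bx_comulM bx_counit1 bx_counitM bx_antipodel bx_antipoder.

Lemma bx_mul_tens (phi psi : Q -> k) a b :
  bx_tens phi a * bx_tens psi b =
  bx_tens (fun x => phi x * psi (a^-1 ▹ x)%g) (a * b)%g.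
Proof.
apply: bext => -[x c]; rewrite [LHS]bx_mulE !bmkE (bigD1 a) //= big1.
  rewrite addr0 !bmkE /= eqxx mulrnAr [(c == _)%g]eq_sym.
  by rewrite (can2_eq (mulKg a) (mulKVg a)) eq_sym.
by move=> d nd; rewrite bmkE /= (negPf nd) mulr0n mul0r.
Qed.

Lemma bx_comul_tens (phi : Q -> k) a : comul (bx_tens phi a) =
  \sum_x \sum_y phi (x * y)%g *: (bx_tens (delta_fun x) a ⊗ bx_tens (delta_fun y) (x^-1 ▹ a)%g).
Proof.
apply: eq_bigr => x _; apply: eq_bigr => y _.
rewrite (bigD1 a) //= big1 => [|b nb]; first by rewrite bmkE eqxx addr0.
by rewrite bmkE /= (negPf nb) mulr0n scale0r.
Qed.

End Bicrossproduct.
Arguments bicrossproduct k {gT G G1 G2} e.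

Section Perfect.
Variable k : fieldType.

Definition module_action (A : falgType k) (V : vectType k)
    (act : A -> V -> V) :=
  [/\ forall v, linear (act^~ v), forall h, linear (act h),
      forall v, act 1 v = v & forall g h v, act (g * h) v = act g (act h v)].

Definition perfect_hopf (H : hopfType k) :=
  forall (V : vectType k) (act : H -> V -> V),
    module_action act -> \dim (fullv : {vspace V}) = 1%N ->
    forall h v, act h v = counit h *: v.

Definition biperfect (H : hopfType k) :=
  perfect_hopf H /\ perfect_hopf (hdual H).

Definition perfect_group (gT : finGroupType) (G : {group gT}) :=
  forall rG : mx_representation k G 1, forall x, x \in G -> rG x = 1%:M.

End Perfect.

Section SL.
Variables (n : nat) (F : finFieldType).
Definition SL : {set {'GL_n[F]}} := [set u | \det (GLval u) == 1].
Lemma SL_group_set : group_set SL.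
Proof.
apply/group_setP; split=> [|u v]; first by rewrite inE GL_1E det1.
by rewrite !inE GL_ME det_mulmx => /eqP-> /eqP->; rewrite mulr1.
Qed.
Canonical SL_group := Group SL_group_set.
Definition PSL := (SL / 'Z(SL))%G.
End SL.

(* (Z/2)^4 ><| A_7, where A_7 acts on the row vectors F_2^4 through the point
   stabilizer embedding A_7 -> A_8 followed by f : A_8 -> GL(4, 2). The
   isomorphisms f : A_8 -> SL(4, 2) fall into two classes modulo inner
   automorphisms; they differ by a transposition of 'S_8, which can be taken to
   normalize A_7, so that the semidirect product does not depend on f. *)
Section A7.
Variable f : {morphism 'Alt_('I_8) >-> {'GL_4['F_2]}}.
Definition A7_A8 (s : 'S_7) : 'S_8 := lift_perm ord_max ord_max s.
Lemma A7_A8_Alt s : s \in 'Alt_('I_7) -> A7_A8 s \in 'Alt_('I_8).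
Proof. by rewrite !Alt_even odd_lift_perm addbb. Qed.
Lemma A7_mx_repr : mx_repr 'Alt_('I_7) (fun s => GLval (f (A7_A8 s))).
Proof.
split=> [|s t As At]; first by rewrite /A7_A8 lift_perm1 morph1.
by rewrite -GL_MxE -morphM ?A7_A8_Alt // lift_permM.
Qed.
Definition A7_repr : mx_representation 'F_2 'Alt_('I_7) 4 :=
  MxRepresentation A7_mx_repr.
Definition affine_A7 := sdprod_by ('MR A7_repr).
End A7.

(* M_24 as the automorphism group of the extended binary Golay code, i.e. of the
   extended quadratic residue code on the 24 points of the projective line over
   F_23, None being the point at infinity. The code is spanned by the full set
   and by the translates of the set of infinity and the 11 nonresidues. *)
Definition P1F23 := option 'F_23.

Definition charvec (A : {set P1F23}) : {ffun P1F23 -> ('F_2)^o} :=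
  [ffun p => (p \in A)%:R].

Definition golay_word (i : 'F_23) : {set P1F23} :=
  None |: [set Some (n + i) | n : 'F_23 & ~~ [exists x, n == x ^+ 2]].

Definition golay : {vspace {ffun P1F23 -> ('F_2)^o}} :=
  (<[charvec setT]> + <<[seq charvec (golay_word i) | i : 'F_23]>>)%VS.

Definition M24 : {group {perm P1F23}} :=
  'N([set A | charvec A \in golay] | 'P^*)%G.

(* Main.v *)
(* PSL(2, 23), acting by Moebius transformations, is regular on the 759 * 8
   flags (octad, point of the octad) of the extended Golay code, so that it is
   an exact complement in M_24 to the stabilizer of a flag. The stabilizer of an
   octad induces A_8 on the octad and affine maps on the 16 points outside, the
   translations being trivial on the octad. An element of M_24 fixing 6 points
   of an octad and a point outside is trivial, because two octads with 5 common
   points are equal; hence a permutation in A_8 determines a matrix, which gives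
   both A_8 = SL(4, 2) and the structure 2^4 : A_7 of the flag stabilizer.
   The normalizer of PSL(2, 23) is controlled by that of a Sylow 23-subgroup
   (Frattini), which consists of the maps x |-> k x + c, and these preserve the
   code only if k is a square. Finally, a one-dimensional module over the
   bicrossproduct amounts to a point of G2 fixed by G1, i.e. an element of N(G1)
   /\ G2 = 1, and a linear character of G1; the dual is symmetric. *)

Require Import Defs.
From HB Require Import structures.
From mathcomp Require Import all_boot all_order all_fingroup all_algebra.
From mathcomp Require Import all_solvable all_field all_character.
From mathcomp Require Import reals complex ring.

Set Implicit Arguments.
Unset Strict Implicit.
Unset Printing Implicit Defensive.

Import GroupScope GRing.Theory.
Local Open Scope ring_scope.

(** * Biperfect bicrossproducts *)

(** The order of M_24 is never computed. Everything about it comes from a test for membership in the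
    code. In systematic form a word lies in the code exactly when re-encoding its first 12 bits
    returns it, so that preserving the code, the minimum weight 8 and the list of octads become
    evaluations on boolean lists. After a point is moved to infinity, regularity on flags concerns
    only the 253 = 11 * 23 affine maps with square multiplier and the 253 octads through infinity.
    The map from A_8 to matrices is not given by a formula. Uniqueness of the matrix makes it
    multiplicative, and explicit matrices are needed only for six 3-cycles. Their relation M^2 + M =
    1 serves twice: it excludes a trivial morphism, and it makes G2 perfect. The rigidity of
    [M24_frame] leaves two points of the octad free. This avoids proving that stabilizers act evenly
    on the octad, since a wrong parity can be corrected on these two points. *)

Lemma selfnormalizing_TI (gT : finGroupType) (G A B : {group gT}) x :
  exact_factorization G A B -> ('N_G(A) = A)%g -> x \in B ->
  A :^ x \subset A -> x = 1%g.
Proof.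
case=> defG tiAB nA Bx sAx; suff: (x \in A :&: B)%g by rewrite tiAB => /set1gP.
by rewrite inE Bx andbT -nA !inE sAx -(mul1g x) -defG mem_mulg.
Qed.

(* A one-dimensional representation of an algebra with a basis multiplying like
   [bx_basis] singles out a point of B fixed by A, i.e. an element of B
   normalizing A, together with a linear character of A. *)
Lemma twisted_character (k : fieldType) (gT : finGroupType)
    (G A B : {group gT}) (e : exact_factorization G A B)
    (chi : subg_of B -> subg_of A -> k) :
    (forall x a y b,
       chi x a * chi y b = (y == a^-1 ▹ x)%g%:R * chi x (a * b)%g) ->
    \sum_x chi x 1%g = 1 -> ('N_G(A) = A)%g -> perfect_group k A ->
  forall x a, chi x a = (x == 1%g)%:R.
Proof.
move=> chiM chi1 nA pA.
(* The scalars [chi x 1] are orthogonal idempotents of a field with sum 1, so exactly one of them,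
   at [x0], equals 1 and the others vanish. *)
have chi11 x y : chi x 1%g * chi y 1%g = (y == x)%:R * chi x 1%g.
  by rewrite chiM invg1 (coset_act1 e) mulg1.
have [x0 nz0] : exists x, chi x 1%g != 0.
  apply/existsP; rewrite -[[exists _, _]]negbK negb_exists; apply/negP=> /forallP z.
  move/eqP: chi1; rewrite big1 1?eq_sym ?oner_eq0 // => x _.
  by apply/eqP; rewrite -[_ == _]negbK z.
have one0 : chi x0 1%g = 1.
  by apply: (mulfI nz0); rewrite chi11 eqxx mul1r mulr1.
have zero x : x != x0 -> chi x 1%g = 0.
  by move=> nx; apply: (mulfI nz0); rewrite chi11 (negPf nx) mul0r mulr0.
have nza (a : subg_of A) : chi x0 a != 0.
  have := chiM x0 a (a^-1 ▹ x0)%g a^-1%g; rewrite eqxx mul1r mulgV one0 => /eqP.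
  by apply: contraTneq => ->; rewrite mul0r eq_sym oner_eq0.
(* Multiplying by the entry at the moved point and 1 gives [chi x0 a], which is nonzero; so that
   entry is nonzero and the moved point is [x0]. *)
have fix0 (a : subg_of A) : (a^-1 ▹ x0)%g = x0.
  have := chiM x0 a (a^-1 ▹ x0)%g 1%g; rewrite eqxx mul1r mulg1.
  by case: (eqVneq (a^-1 ▹ x0)%g x0) => // /zero -> /eqP; rewrite mulr0 eq_sym (negPf (nza a)).
(* Equality of the cosets of [a * x0] and [x0] modulo A, for every [a] in A, says that [x0]
   conjugates A into itself. *)
have x01 : x0 = 1%g.
  apply: val_inj => /=; apply: (selfnormalizing_TI e) => //; first exact: subgP.
  apply/subsetP=> _ /imsetP[a Aa ->].
  have := fix0 (subg A a)^-1%g; rewrite invgK => /esym/(coset_actP e)/eqP.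
  rewrite subgK // lcosetM => /eqP eqx.
  rewrite conjgE; have : (a * sgval x0)%g \in (sgval x0 *: A)%g.
    rewrite -eqx; apply/lcosetP; exists (sgval x0); last by [].
    by apply/lcosetP; exists 1%g; rewrite ?mulg1.
  by rewrite mem_lcoset mulgA.
move: one0 zero nza fix0; rewrite x01 => one0 zero _ _ {nz0}.
have psiM (a b : subg_of A) : chi 1%g a * chi 1%g b = chi 1%g (a * b)%g.
  by rewrite chiM (coset_actx1 e) eqxx mul1r.
have rP : mx_repr A (fun a => (chi 1%g (subg A a))%:M : 'M[k]_1).
  split=> [|a b Aa Ab]; first by rewrite morph1 one0.
  by rewrite -scalar_mxM psiM -morphM.
move=> x a; have [->|nx] := eqVneq; last first.
  by have := chiM x 1%g x a; rewrite invg1 (coset_act1 e) eqxx mul1r mul1g zero ?mul0r.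
have /matrixP/(_ 0 0) := pA (MxRepresentation rP) _ (subgP a).
by rewrite !mxE /= sgvalK.
Qed.

Lemma one_dim_module (k : fieldType) (A : falgType k) (V : vectType k)
    (act : A -> V -> V) :
    module_action act -> \dim (fullv : {vspace V}) = 1%N ->
  exists c : A -> k, [/\ linear (c : A -> k^o), c 1 = 1,
    forall g h, c (g * h) = c g * c h & forall h v, act h v = c h *: v].
Proof.
case=> lin1 lin2 act1 actM dim1.
have i0P : (0 < \dim (fullv : {vspace V}))%N by rewrite dim1.
pose i0 := Ordinal i0P; pose b := (vbasis {:V})`_i0.
pose l := coord (vbasis {:V}) i0.
have lE v : v = l v *: b.
  rewrite {1}(vbasis_exp v) (bigD1 i0) //= big1 ?addr0 // => i.
  rewrite -(inj_eq val_inj) /= -leqn0 -ltnNge => ni.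
  by have := ltn_ord i; rewrite [X in (_ < X)%N]dim1 ltnS leqNgt ni.
have lb : l b = 1 by rewrite /l coord_vb eqxx.
exists (fun h => l (act h b)); split.
- by move=> t g h; rewrite lin1 /l linearP.
- by rewrite act1 lb.
- by move=> g h; rewrite actM {1}(lE (act h b)) linear_fZ // /l linearZ /= mulrC.
- by move=> h v; rewrite {1}(lE v) linear_fZ // {1}(lE (act h b)) scalerA mulrC -scalerA -lE.
Qed.

Section BiperfectBicrossproduct.
Variables (k : fieldType) (gT : finGroupType) (G G1 G2 : {group gT}).
Variable e : exact_factorization G G1 G2.
Local Notation BH := (bicrossproduct k e).
Hypotheses (nG1 : ('N_G(G1) = G1)%g) (nG2 : ('N_G(G2) = G2)%g).
Hypotheses (pG1 : perfect_group k G1) (pG2 : perfect_group k G2).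

Lemma perfect_bicrossproduct : perfect_hopf BH.
Proof.
move=> V act modV dimV; have [c [lc c1 cM actE]] := one_dim_module modV dimV.
move=> h v; rewrite actE; congr (_ *: v); move: h.
apply: (b_ext (U := k^o) lc (@bx_counit_linear _ _ _ _ _ e)) => x a.
rewrite bx_counitE; move: x a; apply: (twisted_character e) => //.
  by move=> x a y b; rewrite -cM bx_basis_mul (linear_fZ _ _ lc).
by rewrite -c1 b1E (linear_sum_raw _ lc).
Qed.

Definition bx_dual_basis x a : hdual BH := hmk (fun h : BH => bval h (x, a)).

Lemma bx_dual_basisE x a (h : BH) : hval (bx_dual_basis x a) h = bval h (x, a).
Proof. exact/hmkE/bval_linear. Qed.

(** The table has the shape of [bx_basis_mul] with the two factors exchanged, so [twisted_character]
    also applies to the dual, through the opposite factorization. *)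
Lemma bx_dual_basis_mul x a y b :
  bx_dual_basis x a * bx_dual_basis y b =
    (b == x^-1 ▹ a)%g%:R *: bx_dual_basis (x * y)%g a.
Proof.
apply: hdual_ext; apply: (b_ext (U := k^o)); try exact: hval_linear.
move=> z c; rewrite scale_ev bx_dual_basisE [LHS]dual_mulE.
rewrite [LHS]tlift_bcomul; last exact: bilin_hh.
under eq_bigr do rewrite !bx_dual_basisE !bx_basisE.
rewrite (bigD1 x) //= big1 ?addr0 => [|w /negPf nw]; last first.
  by rewrite eq_sym nw mul0r.
rewrite eqxx -!natrM !mulnb [(y == _)%g]eq_sym (can2_eq (mulKVg x) (mulKg x)) /=.
rewrite bx_basisE -natrM mulnb; case: (a =P c) => [->|]; last by rewrite ?andbF.
by rewrite /= andbT (eq_sym z) andbC.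
Qed.

Lemma bx_dual_exp (f : hdual BH) :
  f = \sum_x \sum_a hval f (bx_basis k e x a) *: bx_dual_basis x a.
Proof.
apply: hdual_ext => h; rewrite {1}(b_exp h).
rewrite (linear_sum_raw _ (hval_linear f)) (linear_sum_raw _ (ev_linear h)).
apply: eq_bigr => x _.
rewrite (linear_sumZ _ _ (hval_linear f)) (linear_sumZ _ _ (ev_linear h)).
by apply: eq_bigr => a _; rewrite bx_dual_basisE [RHS]mulrC.
Qed.

Lemma perfect_dual_bicrossproduct : perfect_hopf (hdual BH).
Proof.
move=> V act modV dimV; have [c [lc c1 cM actE]] := one_dim_module modV dimV.
move=> f v; rewrite actE; congr (_ *: v).
have cE a x : c (bx_dual_basis x a) = (a == 1%g)%:R.
  move: a x; apply: (twisted_character (exact_factorizationC e)) => //.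
    by move=> a x b y; rewrite -cM bx_dual_basis_mul (linear_fZ _ _ lc).
  rewrite -c1 -(linear_sum_raw _ lc); congr c; apply: hdual_ext => h.
  rewrite (linear_sum_raw _ (ev_linear h)) hval1.
  by apply: eq_bigr => a _; rewrite bx_dual_basisE.
rewrite -[counit f]/(hval f 1) b1E (linear_sum_raw _ (hval_linear f)).
rewrite {1}(bx_dual_exp f) (linear_sum_raw _ lc); apply: eq_bigr => x _.
rewrite (linear_sumZ _ _ lc) (bigD1 1%g) //= big1 ?addr0 => [|a /negPf na].
  by rewrite cE eqxx [LHS]mulr1.
by rewrite cE na [LHS]mulr0.
Qed.

Lemma biperfect_bicrossproduct : biperfect BH.
Proof. by split; [exact: perfect_bicrossproduct | exact: perfect_dual_bicrossproduct]. Qed.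

End BiperfectBicrossproduct.

(** * The extended Golay code in coordinates *)

(* The point at infinity has index 23. *)
Definition pt (n : nat) : P1F23 := if (n < 23)%N then Some n%:R else None.
Definition ix (p : P1F23) : nat := if p is Some x then x : nat else 23.

Lemma F23_lt (x : 'F_23) : (x < 23)%N.
Proof. exact: ltn_ord. Qed.

Lemma val_F23 n : (n%:R : 'F_23) = (n %% 23)%N :> nat.
Proof. exact: val_Fp_nat. Qed.

Lemma ixK : cancel ix pt.
Proof.
case=> [x|] //; rewrite /pt /ix F23_lt; congr Some; apply: val_inj.
by rewrite /= val_F23 modn_small ?F23_lt.
Qed.

Lemma ptK n : (n < 24)%N -> ix (pt n) = n.
Proof.
rewrite ltnS leq_eqVlt /pt => /orP[/eqP->//|lt_n]; rewrite lt_n /=.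
by rewrite val_F23 modn_small.
Qed.

Lemma ix_lt p : (ix p < 24)%N.
Proof. by case: p => [x|//]; apply: leq_trans (F23_lt x) _. Qed.

Definition bits (A : {set P1F23}) : seq bool := [seq pt n \in A | n <- iota 0 24].
Definition xorw (u v : seq bool) := [seq p.1 (+) p.2 | p <- zip u v].
Definition zerow := nseq 24 false.

Lemma size_bits A : size (bits A) = 24.
Proof. by rewrite size_map size_iota. Qed.

Lemma nth_bits A n : (n < 24)%N -> nth false (bits A) n = (pt n \in A).
Proof. by move=> lt_n; rewrite (nth_map 0) ?size_iota // nth_iota. Qed.

Lemma nth_bits_ix A p : nth false (bits A) (ix p) = (p \in A).
Proof. by rewrite nth_bits ?ix_lt // ixK. Qed.

Lemma size_xorw u v : size u = size v -> size (xorw u v) = size v.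
Proof. by move=> e; rewrite size_map size1_zip // e. Qed.

Definition wvec (w : seq bool) : {ffun P1F23 -> ('F_2)^o} :=
  [ffun p => (nth false w (ix p))%:R].

Lemma charvec_bits A : charvec A = wvec (bits A).
Proof. by apply/ffunP=> p; rewrite !ffunE nth_bits_ix. Qed.

Lemma F2_boolK (b : bool) : ((b%:R : 'F_2) != 0) = b.
Proof. by case: b. Qed.

Lemma F2_addb (b c : bool) : (b (+) c)%:R = b%:R + c%:R :> 'F_2.
Proof. by apply: val_inj; case: b; case: c. Qed.

Lemma F2_boolE (x : 'F_2) : x = (x != 0)%:R.
Proof. by apply: val_inj; case: x => -[|[|n]]. Qed.

Lemma wvec_inj u v : size u = 24 -> size v = 24 -> wvec u = wvec v -> u = v.
Proof.
move=> su sv /ffunP eq; apply: (@eq_from_nth _ false) => [|n]; rewrite su // => lt_n.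
by have:= eq (pt n); rewrite !ffunE ptK // => /(congr1 (fun x => x != 0)); rewrite !F2_boolK.
Qed.

Lemma wvec_xor u v : size u = 24 -> size v = 24 -> wvec (xorw u v) = wvec u + wvec v.
Proof.
move=> su sv; apply/ffunP=> p; rewrite !ffunE (nth_map (false, false)) ?size_zip ?su ?sv ?ix_lt //.
by rewrite nth_zip ?su // F2_addb.
Qed.

Lemma wvec_zero : wvec zerow = 0.
Proof. by apply/ffunP=> p; rewrite !ffunE nth_nseq ix_lt. Qed.

Fixpoint enc (rs : seq (seq bool)) (c acc : seq bool) : seq bool :=
  match rs, c with
  | r :: rs', b :: c' => enc rs' c' (if b then xorw r acc else acc)
  | _, _ => acc
  end.

Definition wordn (n : nat) (w : seq bool) := size w == n.

Lemma size_enc n rs c acc : all (wordn n) rs -> size acc = n -> size (enc rs c acc) = n.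
Proof.
elim: rs c acc => [|r rs IH] [|b c] acc //= /andP[/eqP sr /IH{}IH] sa; apply: IH.
by case: b; rewrite ?size_xorw // sa.
Qed.

Lemma enc_additive (V : lmodType 'F_2) n (f : seq bool -> V) rs c acc :
  (forall u v, size u = n -> size v = n -> f (xorw u v) = f u + f v) ->
  all (wordn n) rs -> size acc = n ->
  f (enc rs c acc) = f acc + \sum_(x <- zip rs c) x.2%:R *: f x.1.
Proof.
move=> fD; elim: rs c acc => [|r rs IH] [|b c] acc /=; rewrite ?big_nil ?addr0 //.
case/andP=> /eqP sr /IH{}IH sa; rewrite big_cons IH; last first.
  by case: b; rewrite ?size_xorw // sa.
case: b => /=; last by rewrite scale0r add0r.
by rewrite fD // scale1r addrA [f r + _]addrC.
Qed.

(** Partial sums are shared along a binary tree, which lets [vm_compute] inspect all 4096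
    codewords. *)
Fixpoint all_words (rs : seq (seq bool)) (acc : seq bool) (P : pred (seq bool)) :=
  if rs is r :: rs' then all_words rs' acc P && all_words rs' (xorw r acc) P
  else P acc.

Lemma all_wordsP rs acc P c : all_words rs acc P -> size c = size rs -> P (enc rs c acc).
Proof.
by elim: rs acc c => [|r rs IH] acc [|[] c] //= /andP[w0 w1] [sc]; apply: IH.
Qed.

(* Row i is the codeword with i as only element in {0, ..., 11}, so that a
   codeword is determined by its first 12 bits. *)
Definition word_of (s : seq nat) : seq bool := [seq n \in s | n <- iota 0 24].
Definition golay_rows : seq (seq bool) := map word_of
  [:: [:: 0; 12; 14; 16; 17; 18; 22; 23]; [:: 1; 12; 13; 14; 15; 16; 19; 22];
      [:: 2; 12; 13; 15; 18; 20; 22; 23]; [:: 3; 12; 13; 17; 18; 19; 21; 22];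
      [:: 4; 12; 13; 16; 17; 19; 20; 23]; [:: 5; 13; 14; 17; 18; 20; 21; 23];
      [:: 6; 14; 15; 18; 19; 21; 22; 23]; [:: 7; 12; 14; 15; 17; 18; 19; 20];
      [:: 8; 13; 15; 16; 18; 19; 20; 21]; [:: 9; 14; 16; 17; 19; 20; 21; 22];
      [:: 10; 12; 14; 15; 16; 20; 21; 23]; [:: 11; 13; 15; 16; 17; 21; 22; 23]]%N.

Definition encode (c : seq bool) := enc golay_rows c zerow.
Definition codeword (w : seq bool) := encode (take 12 w) == w.

Definition nonresidues23 := [:: 5; 7; 10; 11; 14; 15; 17; 19; 20; 21; 22]%N.

Lemma nonresidue23P (n : 'F_23) :
  ~~ [exists x : 'F_23, n == x ^+ 2] = ((n : nat) \in nonresidues23).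
Proof.
have chk : all (fun n => (n \in nonresidues23) ==
    all (fun x => n != (x * x) %% 23)%N (iota 0 23)) (iota 0 23) by vm_compute.
have memi (x : 'F_23) : (x : nat) \in iota 0 23 by rewrite mem_iota F23_lt.
have sqE (x : 'F_23) : (x ^+ 2 : 'F_23) = ((x * x) %% 23)%N :> nat by [].
rewrite (eqP (allP chk _ (memi n))); apply/idP/allP=> [|H].
  rewrite negb_exists => /forallP H x; rewrite mem_iota add0n => /andP[_ lx].
  have := H x%:R; apply: contraNneq => eqn; apply/eqP/val_inj; apply: etrans eqn _.
  by symmetry; apply: etrans (sqE _) _; rewrite !val_F23 (modn_small lx).
rewrite negb_exists; apply/forallP=> x; apply/eqP=> /(congr1 (@nat_of_ord _)).
by rewrite sqE; apply/eqP/H.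
Qed.

(** Index 0 is the full set and index [i.+1] the translate by [i]; the summand [23 - i] is [-i]
    modulo 23, written without truncated subtraction. *)
Definition gen_word (k : nat) : seq bool :=
  if k is i.+1 then
    [seq (n == 23%N) || ((n + (23 - i)) %% 23 \in nonresidues23)%N | n <- iota 0 24]
  else nseq 24 true.

Lemma gen_word0 : wvec (gen_word 0) = charvec setT.
Proof. by apply/ffunP=> p; rewrite !ffunE inE nth_nseq ix_lt. Qed.

Lemma gen_wordS (i : 'F_23) : wvec (gen_word i.+1) = charvec (golay_word i).
Proof.
apply/ffunP=> p; rewrite !ffunE (nth_map 0%N) ?size_iota ?ix_lt // nth_iota ?ix_lt //.
rewrite add0n in_setU1; congr (nat_of_bool _)%:R; case: p => [x|] //.
rewrite [ix _]/= ltn_eqF ?F23_lt //; symmetry; rewrite [Some x == _]/= orFb.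
have <- : (x - i : 'F_23) = ((x + (23 - i)) %% 23)%N :> nat.
  by rewrite -[RHS]modnDmr.
apply: (etrans _ (nonresidue23P (x - i))); apply/imsetP/idP=> [[n ni [->]]|nr].
  by rewrite addrK; rewrite inE in ni.
by exists (x - i); rewrite ?inE // subrK.
Qed.

Lemma gen_word_golay k : (k < 24)%N -> wvec (gen_word k) \in golay.
Proof.
case: k => [|i] lti.
  by rewrite gen_word0 -[charvec _]addr0 memv_add ?memv_line ?mem0v.
have -> : i = (i%:R : 'F_23) by rewrite val_F23 modn_small.
rewrite gen_wordS -[charvec _]add0r memv_add ?mem0v //.
by apply/memv_span/mapP; exists i%:R; rewrite ?mem_enum.
Qed.

Lemma size_gen_word k : size (gen_word k) = 24.
Proof. by case: k => [|i]; rewrite ?size_nseq // size_map size_iota. Qed.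

Definition gen_combination (ks : seq nat) : seq bool :=
  foldr (fun k => xorw (gen_word k)) zerow ks.

Lemma gen_combination_golay ks : all (fun k => k < 24)%N ks ->
  size (gen_combination ks) = 24 /\ wvec (gen_combination ks) \in golay.
Proof.
elim: ks => [|k ks IH] /=; first by rewrite wvec_zero mem0v.
case/andP=> /gen_word_golay gk /IH[sk IHk]; split.
  by rewrite size_xorw ?size_gen_word ?sk.
by rewrite wvec_xor ?size_gen_word // memvD.
Qed.

Lemma size_golay_row r : r \in golay_rows -> size r = 24.
Proof. by move=> /mapP[s _ ->]; rewrite size_map size_iota. Qed.

Lemma golay_rows24 : all (wordn 24) golay_rows.
Proof. by apply/allP=> r /size_golay_row; rewrite /wordn => ->. Qed.

Lemma golay_row_golay r : r \in golay_rows -> wvec r \in golay.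
Proof.
(* The rows as sums of generators, found by Gaussian elimination. *)
pose kss := [:: [:: 0; 1; 4; 6; 8; 10; 11]; [:: 0; 4; 5; 9]; [:: 1; 4; 5; 8; 11];
  [:: 4; 5; 6; 7; 9; 11]; [:: 2; 4; 5; 6; 8; 10; 11];
  [:: 0; 1; 2; 3; 5; 8; 9; 10; 11]; [:: 1; 3; 4; 7; 8; 9; 11];
  [:: 5; 7; 8; 9; 10; 11]; [:: 0; 1; 2; 7; 9; 11]; [:: 1; 3; 6; 7];
  [:: 0; 1; 2; 6; 7; 10; 11]; [:: 1; 3; 6; 10; 11]]%N.
have -> : golay_rows = map gen_combination kss by vm_compute.
case/mapP=> ks mem_ks ->; have [] // := @gen_combination_golay ks.
by move: ks mem_ks; apply/allP.
Qed.

Lemma sum_zip_take (K : nzRingType) (V : lmodType K) (T : Type) (x0 : T)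
    (f : T -> V) (rs : seq T) (w : seq bool) :
  \sum_(x <- zip rs (take (size rs) w)) x.2%:R *: f x.1 =
    \sum_(i < size rs) (nth false w i)%:R *: f (nth x0 rs i).
Proof.
have [le_w|/ltnW lt_w] := leqP (size rs) (size w).
  rewrite (big_nth (x0, false)) size_zip size_takel // minnn big_mkord.
  by apply: eq_bigr => i _; rewrite nth_zip ?size_takel //= nth_take.
rewrite take_oversize // (big_nth (x0, false)) size_zip (minn_idPr lt_w) big_mkord.
rewrite (big_ord_widen _ (fun i => (nth (x0, false) (zip rs w) i).2%:R
  *: f (nth (x0, false) (zip rs w) i).1) lt_w).
rewrite big_mkcond; apply: eq_bigr => i _.
rewrite nth_zip_cond size_zip (minn_idPr lt_w).
by case: ltnP => // le_i; rewrite nth_default // scale0r.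
Qed.

Lemma wvec_encode w :
  wvec (encode (take 12 w)) =
    \sum_(i < 12) (nth false w i)%:R *: wvec (nth zerow golay_rows i).
Proof.
rewrite (enc_additive _ wvec_xor) ?golay_rows24 // wvec_zero add0r.
exact: (sum_zip_take zerow wvec golay_rows).
Qed.

(** The linear projection onto the code that keeps the first 12 coordinates. The code is its fixed
    space, so inclusions need to be tested only on generators. *)
Definition golay_proj (v : {ffun P1F23 -> ('F_2)^o}) : {ffun P1F23 -> ('F_2)^o} :=
  \sum_(i < 12) (v (pt i) : 'F_2) *: wvec (nth zerow golay_rows i).

Lemma golay_proj_linear : linear golay_proj.
Proof.
move=> a u v; rewrite scaler_sumr -big_split; apply: eq_bigr => i _ /=.
by rewrite !ffunE scalerDl scalerA.
Qed.

HB.instance Definition _ := GRing.isLinear.Build _ _ _ _ golay_proj golay_proj_linear.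

Lemma golay_proj_wvec w : golay_proj (wvec w) = wvec (encode (take 12 w)).
Proof.
rewrite wvec_encode; apply: eq_bigr => i _.
by rewrite ffunE ptK // (leq_trans (ltn_ord i)).
Qed.

Lemma golay_projE v : v \in golay -> v = golay_proj v.
Proof.
have chk k : (k < 24)%N -> golay_proj (wvec (gen_word k)) = wvec (gen_word k).
  have C : all codeword (map gen_word (iota 0 24)) by vm_compute.
  move=> lt_k; rewrite golay_proj_wvec; congr wvec.
  by apply/eqP/(allP C)/map_f; rewrite mem_iota.
suff /subvP sub : (golay <= fixedSpace (linfun golay_proj))%VS.
  by move/sub/fixedSpaceP; rewrite lfunE.
rewrite subv_add -memvE; apply/andP; split.
  by apply/fixedSpaceP; rewrite lfunE -gen_word0; apply: chk.
apply/span_subvP=> _ /mapP[i _ ->]; apply/fixedSpaceP.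
by rewrite lfunE -gen_wordS; apply: chk; rewrite ltnS F23_lt.
Qed.

Lemma golay_proj_golay v : golay_proj v \in golay.
Proof.
by apply: memv_suml => i _; rewrite memvZ // golay_row_golay // mem_nth.
Qed.

Lemma golayE v : (v \in golay) = (golay_proj v == v).
Proof.
apply/idP/eqP=> [/golay_projE/esym//|<-]; exact: golay_proj_golay.
Qed.

Lemma size_encode c : size (encode c) = 24.
Proof. by rewrite (size_enc _ golay_rows24). Qed.

Lemma wvec_golay w : size w = 24 -> (wvec w \in golay) = codeword w.
Proof.
move=> sw; rewrite golayE golay_proj_wvec; apply/eqP/eqP => [|->//].
by apply: wvec_inj => //; rewrite size_encode.
Qed.

Lemma charvec_golay A : (charvec A \in golay) = codeword (bits A).
Proof. by rewrite charvec_bits wvec_golay ?size_bits. Qed.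

Lemma card_bits (A : {set P1F23}) : #|A| = count id (bits A).
Proof.
rewrite cardE -(size_map ix) count_map -size_filter.
have uix (s : seq P1F23) : uniq s -> uniq (map ix s).
  by rewrite map_inj_uniq //; apply: can_inj ixK.
apply/perm_size/uniq_perm; rewrite ?uix ?enum_uniq ?filter_uniq ?iota_uniq //.
move=> n; rewrite mem_filter mem_iota /=; apply/mapP/andP=> [[p]|[An lt_n]].
  by rewrite mem_enum => Ap ->; rewrite ixK ix_lt.
by exists (pt n); rewrite ?mem_enum ?ptK.
Qed.

Lemma M24P (g : {perm P1F23}) : reflect
  (forall A : {set P1F23}, charvec A \in golay -> charvec (g @: A) \in golay) (g \in M24).
Proof.
apply: (iffP idP) => [gM A gA|H].
  have := astabs_act A gM; rewrite !inE => e.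
  by move: gA; rewrite -e; congr (charvec _ \in _).
rewrite !inE; apply/subsetP=> A; rewrite !inE => /H; congr (charvec _ \in _).
Qed.

Definition perm_word (t : seq nat) (w : seq bool) := [seq nth false w n | n <- t].

(** Reading a word through the table of [g] is pulling it back along [g], i.e. applying the inverse
    of [g]. Hence the inverse is shown to preserve the code, which by linearity is a condition on
    the 12 rows. *)
Lemma table_M24 (g : {perm P1F23}) (t : seq nat) : size t = 24 ->
  (forall n, (n < 24)%N -> g (pt n) = pt (nth 0 t n)) ->
  all (fun n => n < 24)%N t ->
  all (fun r => codeword (perm_word t r)) golay_rows -> g \in M24.
Proof.
move=> st gt t24 chk; rewrite -groupV; apply/M24P=> A gA.
pose T (v : {ffun P1F23 -> ('F_2)^o}) : {ffun P1F23 -> ('F_2)^o} := [ffun p => v (g p)].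
have linT : linear T by move=> a u v; apply/ffunP=> p; rewrite !ffunE.
have -> : charvec (g^-1%g @: A) = T (charvec A).
  apply/ffunP=> p; rewrite !ffunE; congr (nat_of_bool _)%:R.
  by rewrite -{1}(permK g p) mem_imset //; apply: perm_inj.
rewrite (golay_projE gA) (linear_sumZ _ _ linT).
apply: memv_suml => i _; rewrite memvZ //.
set r := nth _ _ _; have gr : r \in golay_rows by rewrite mem_nth.
have -> : T (wvec r) = wvec (perm_word t r).
  apply/ffunP=> p; rewrite !ffunE -{1}(ixK p) gt ?ix_lt // ptK.
    by rewrite (nth_map 0) ?st ?ix_lt.
  by apply: (allP t24); rewrite mem_nth ?st ?ix_lt.
by rewrite wvec_golay ?(allP chk) // size_map.
Qed.

(** * Octads *)

(** Any octad through infinity would serve: they form a single orbit under the stabilizer of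
    infinity in PSL(2, 23). *)
Definition octad_word : seq bool := word_of [:: 0; 1; 2; 3; 5; 14; 17; 23]%N.
Definition octad : {set P1F23} := [set p | nth false octad_word (ix p)].

Definition squares23 := [:: 1; 2; 3; 4; 6; 8; 9; 12; 13; 16; 18]%N.

(* The image of [octad] under the inverse of x |-> s x + c. *)
Definition affine_word (s c : nat) : seq bool :=
  [seq (n == 23) || nth false octad_word ((s * n + c) %% 23) | n <- iota 0 24]%N.

Definition affine_words := [seq affine_word s c | s <- squares23, c <- iota 0 23].

(* The 253 octads through infinity are the images of [octad] under the
   stabilizer of infinity in PSL(2, 23). *)
Lemma golay_words_check :
  all_words golay_rows zerow (fun w =>
    if w == zerow then true else
    if (count id w < 8)%N then false else
    if (count id w == 8)%N then nth false w 23 ==> (w \in affine_words) else true).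
Proof. by vm_compute. Qed.

Lemma golay_word_cases (A : {set P1F23}) : charvec A \in golay ->
  A = set0 \/ (8 <= #|A|)%N /\ (#|A| = 8 -> None \in A ->
    exists s c, [/\ s \in squares23, (c < 23)%N & bits A = affine_word s c]).
Proof.
rewrite charvec_golay card_bits => /eqP eqA.
have sA : size (take 12 (bits A)) = size golay_rows by rewrite size_takel ?size_bits.
have := all_wordsP golay_words_check sA; rewrite -/(encode _) eqA => H.
move: H; case: eqP => [A0 _|_ H]; [left | right].
  by apply/eqP; rewrite -cards_eq0 card_bits A0.
move: H; case: ltnP => // ge8 H; split=> // A8 Ainf; move: H.
rewrite A8 eqxx nth_bits // [_ \in A]Ainf.
by case/allpairsP=> -[s c] [ss]; rewrite mem_iota => lc e; exists s, c.
Qed.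

Lemma golay_weight (A : {set P1F23}) : charvec A \in golay -> (#|A| < 8)%N -> A = set0.
Proof. by case/golay_word_cases=> // -[ge8 _]; rewrite ltnNge ge8. Qed.

Lemma charvec_symdiff (A B : {set P1F23}) :
  charvec (A :\: B :|: B :\: A) = charvec A + charvec B.
Proof.
apply/ffunP=> p; rewrite !ffunE -F2_addb; congr (nat_of_bool _)%:R.
by rewrite !inE; case: (p \in A); case: (p \in B).
Qed.

(** [C] and its image both contain [F], so their symmetric difference is a codeword of weight at
    most 3 + 3, below the minimum weight 8. *)
Lemma octad_stable (g : {perm P1F23}) (C F : {set P1F23}) : g \in M24 ->
  charvec C \in golay -> #|C| = 8 -> F \subset C -> {in F, forall p, g p = p} ->
  (5 <= #|F|)%N -> g @: C = C.
Proof.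
move=> gM gC C8 sFC fixF F5; have sFgC : F \subset g @: C.
  by apply/subsetP=> p Fp; apply/imsetP; exists p; rewrite ?fixF // (subsetP sFC).
have gC8 : #|g @: C| = 8 by rewrite card_imset //; apply: perm_inj.
have small (A B : {set P1F23}) : #|A| = 8 -> F \subset A -> F \subset B -> (#|A :\: B| <= 3)%N.
  move=> A8 sFA sFB; have sub : A :\: B \subset A :\: F by apply: setDS.
  apply: leq_trans (subset_leq_card sub) _.
  by rewrite cardsD (setIidPr sFA) A8 leq_subLR (leq_trans _ (leq_add F5 (leqnn 3))).
have : g @: C :\: C :|: C :\: g @: C = set0.
  apply: golay_weight.
    by rewrite charvec_symdiff memvD //; apply: (M24P _ gM).
  by apply: leq_ltn_trans (leq_card_setU _ _) _; rewrite (leq_ltn_trans (leq_add (small _ _ _ _ _) (small _ _ _ _ _))).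
by move/eqP; rewrite setU_eq0 !setD_eq0 => /andP[? ?]; apply/eqP; rewrite eqEsubset; apply/andP.
Qed.

Definition set_of_word (w : seq bool) : {set P1F23} := [set p | nth false w (ix p)].

Lemma bits_set_of_word w : size w = 24 -> bits (set_of_word w) = w.
Proof.
move=> sw; apply: (@eq_from_nth _ false); rewrite size_bits ?sw // => n lt_n.
by rewrite nth_bits // inE ptK.
Qed.

Lemma octad_golay : charvec octad \in golay.
Proof. by rewrite charvec_golay bits_set_of_word //; vm_compute. Qed.

Lemma card_octad : #|octad| = 8.
Proof. by rewrite card_bits bits_set_of_word. Qed.

(* Octads meeting the set S of fixed points at least 5 times are stable, hence
   so are the intersections of such octads. *)
Definition separates (S : seq nat) (Ls : seq (seq nat)) (y : nat) :=
  [&& all (fun L => let w := word_of L in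
        [&& codeword w, count id w == 8 & 5 <= size [seq n <- S | n \in L]]%N) Ls,
      uniq S, all (fun n => n < 24)%N S, y \notin S &
      all (fun z => [|| z == y, z \in S
                      | has (fun L => (y \in L) && (z \notin L)) Ls]) (iota 0 24)].

(** The image of [y] is not in [S], by injectivity; any other candidate [z] is cut off from [y] by a
    stable octad containing [y] but not [z]. *)
Lemma fixed_by_separation (g : {perm P1F23}) S Ls y : g \in M24 ->
  {in S, forall n, g (pt n) = pt n} -> (y < 24)%N -> separates S Ls y ->
  g (pt y) = pt y.
Proof.
move=> gM fixS lt_y /and5P[/allP chkL uS /allP S24 nSy /allP sep].
pose z := ix (g (pt y)); have zE : pt z = g (pt y) by rewrite ixK.
have := sep z; rewrite mem_iota ix_lt => /(_ isT) /or3P[/eqP e|Sz|].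
- by rewrite -zE e.
- have : g (pt z) = g (pt y) by rewrite fixS.
  move/perm_inj/(congr1 ix); rewrite !ptK ?ix_lt // => e.
  by rewrite e (negPf nSy) in Sz.
case/hasP=> L /chkL/and3P[cL /eqP L8 L5] /andP[Ly Lz].
pose w := word_of L; have sw : size w = 24 by rewrite size_map size_iota.
have wE n : (n < 24)%N -> (pt n \in set_of_word w) = (n \in L).
  by move=> lt_n; rewrite inE ptK // (nth_map 0) ?size_iota // nth_iota.
pose F := [set p in [seq pt n | n <- S & n \in L]].
have inj_pt : {in [seq n <- S | n \in L] &, injective pt}.
  move=> m n; rewrite !mem_filter => /andP[_ /S24 lm] /andP[_ /S24 ln] /(congr1 ix).
  by rewrite !ptK.
have gC : g @: set_of_word w = set_of_word w.
  apply: (octad_stable (F := F)) => //.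
  - by rewrite charvec_golay bits_set_of_word.
  - by rewrite card_bits bits_set_of_word.
  - apply/subsetP=> p; rewrite inE => /mapP[n]; rewrite mem_filter => /andP[Ln /S24 ln] ->.
    by rewrite wE.
  - by move=> p; rewrite inE => /mapP[n]; rewrite mem_filter => /andP[_ /fixS e] ->.
  - rewrite cardsE.
    have /card_uniqP-> : uniq [seq pt n | n <- S & n \in L].
      by rewrite (map_inj_in_uniq inj_pt) filter_uniq.
    by rewrite size_map.
have : g (pt y) \in g @: set_of_word w by rewrite imset_f // wE.
by rewrite gC -zE wE ?ix_lt // (negPf Lz).
Qed.

(* Six points of [octad], and one point outside. *)
Definition frame := [:: 2; 3; 5; 14; 17; 23; 4]%N.

Lemma M24_frame (g : {perm P1F23}) : g \in M24 ->
  {in frame, forall n, g (pt n) = pt n} -> g = 1%g.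
Proof.
move=> gM fixF.
(* Octads through the point outside, 4, and four of the six points inside. *)
pose Ls := [:: [:: 3; 4; 5; 13; 14; 16; 17; 22]; [:: 2; 4; 6; 14; 16; 17; 21; 23];
  [:: 2; 4; 5; 8; 14; 18; 22; 23]; [:: 2; 3; 4; 7; 8; 14; 15; 17];
  [:: 3; 4; 9; 14; 17; 18; 19; 23]; [:: 2; 3; 4; 5; 6; 9; 12; 14];
  [:: 2; 3; 4; 10; 13; 14; 20; 23]; [:: 4; 5; 7; 10; 12; 14; 17; 23];
  [:: 2; 4; 5; 11; 14; 17; 19; 20]; [:: 3; 4; 5; 11; 14; 15; 21; 23]]%N.
have chk1 : all (fun y => (y \in frame) || separates frame Ls y) (iota 2 22).
  by vm_compute.
have fix2 : {in iota 2 22, forall n, g (pt n) = pt n}.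
  move=> n n2; have /orP[/fixF//|sep] := allP chk1 n n2.
  have lt_n : (n < 24)%N by move: n2; rewrite mem_iota => /andP[].
  exact: (fixed_by_separation gM fixF lt_n sep).
(* The points 0 and 1 are the rest of [octad]. The octads listed above avoid both, so these two
   points are separated only now, by two octads meeting the 22 points already fixed. *)
have chk2 : all (separates (iota 2 22)
    [:: [:: 0; 12; 14; 16; 17; 18; 22; 23]; [:: 1; 12; 13; 14; 15; 16; 19; 22]]%N)
    [:: 0; 1]%N by vm_compute.
apply/permP=> p; rewrite perm1 -(ixK p); have lt_p := ix_lt p.
have [le2|lt2] := leqP 2 (ix p); first by apply: fix2; rewrite mem_iota le2.
apply: (fixed_by_separation gM fix2 lt_p (allP chk2 _ _)).
by rewrite !inE; case: (ix p) lt2 => [|[|]].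
Qed.

(** * The octad stabilizer and the isomorphism from A_8 to SL(4, 2) *)

(* The decomposition of the 24 points into the octad, labelled by 'I_8 with the
   point at infinity last, and its complement, labelled by F_2^4. The stabilizer
   of the octad acts on the complement by affine maps. *)
Definition labels : seq nat :=
  [:: 0; 1; 2; 3; 5; 14; 17; 23;
      4; 13; 12; 18; 20; 10; 21; 7; 22; 16; 11; 8; 15; 9; 19; 6]%N.

Definition code (b : seq bool) : nat := foldr (fun (x : bool) n => x + n.*2)%N 0%N b.
Definition decode (n : nat) : seq bool :=
  [:: odd n; odd n./2; odd n./2./2; odd n./2./2./2].

Definition vrow (b : seq bool) : 'rV['F_2]_4 := \row_j (nth false b j)%:R.
Definition vbits (v : 'rV['F_2]_4) : seq bool := [seq v 0 j != 0 | j <- enum 'I_4].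

Lemma size_vbits v : size (vbits v) = 4.
Proof. by rewrite size_map size_enum_ord. Qed.

Lemma nth_vbits v (j : 'I_4) : nth false (vbits v) j = (v 0 j != 0).
Proof. by rewrite (nth_map j) ?size_enum_ord // nth_ord_enum. Qed.

Lemma vbitsK : cancel vbits vrow.
Proof. by move=> v; apply/rowP=> j; rewrite mxE nth_vbits -F2_boolE. Qed.

Lemma vrowK b : size b = 4 -> vbits (vrow b) = b.
Proof.
move=> sb; apply: (@eq_from_nth _ false); rewrite size_vbits ?sb // => j lt_j.
by rewrite (nth_vbits _ (Ordinal lt_j)) mxE F2_boolK.
Qed.

Lemma decodeK b : size b = 4 -> decode (code b) = b.
Proof. by case: b => [|[] [|[] [|[] [|[] []]]]]. Qed.

Lemma code_lt b : size b = 4 -> (code b < 16)%N.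
Proof. by case: b => [|[] [|[] [|[] [|[] []]]]]. Qed.

Lemma codeK n : (n < 16)%N -> code (decode n) = n.
Proof.
move=> lt_n; apply/eqP; apply: (allP (s := iota 0 16) (a := fun n => code (decode n) == n)).
  by vm_compute.
by rewrite mem_iota.
Qed.

Lemma vrow_xor u v : size u = 4 -> size v = 4 -> vrow (xorw u v) = vrow u + vrow v.
Proof.
move=> su sv; apply/rowP=> j; rewrite !mxE (nth_map (false, false)) ?size_zip ?su ?sv //.
by rewrite nth_zip ?su // F2_addb.
Qed.

Definition lam (x : 'I_8 + 'rV['F_2]_4) : P1F23 :=
  pt (nth 0%N labels (match x with inl i => i : nat | inr v => 8 + code (vbits v) end)).

Definition lam_inv (p : P1F23) : 'I_8 + 'rV['F_2]_4 :=
  let k := index (ix p) labels in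
  if (k < 8)%N then inl (inord k) else inr (vrow (decode (k - 8))).

Lemma labels_lt k : (nth 0 labels k < 24)%N.
Proof.
have [lt_k|le_k] := ltnP k 24; last by rewrite nth_default.
by apply: (allP (s := labels) (a := fun n => n < 24)%N) => //; rewrite mem_nth.
Qed.

Lemma lamK : cancel lam lam_inv.
Proof.
move=> x; rewrite /lam /lam_inv ptK ?labels_lt //.
have [lt_i|] := boolP (match x with inl i => i : nat | inr v => 8 + code (vbits v) end < 24)%N.
  rewrite index_uniq //; case: x lt_i => [i|v] _.
    by rewrite ltn_ord inord_val.
  by rewrite ltnNge leq_addr /= addKn decodeK ?size_vbits // vbitsK.
case: x => [i|v]; first by rewrite (leq_trans (ltn_ord i)).
by rewrite (leq_add2l 8 _ 16) code_lt ?size_vbits.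
Qed.

Lemma lam_invK : cancel lam_inv lam.
Proof.
move=> p; rewrite /lam_inv /lam.
have lt_p : (index (ix p) labels < 24)%N.
  rewrite (index_mem (ix p) labels); have := ix_lt p; move: (ix p) => n lt_n.
  by apply: (allP (s := iota 0 24) (a := [in labels])) => //; rewrite mem_iota.
have memp : ix p \in labels by rewrite -index_mem.
case: ltnP => [lt8|le8]; first by rewrite inordK // nth_index // ixK.
rewrite vrowK // codeK; last by rewrite ltn_subLR.
by rewrite subnKC // nth_index // ixK.
Qed.

Lemma lam_inj : injective lam. Proof. exact: can_inj lamK. Qed.

Lemma mem_octad x : (lam x \in octad) = if x is inl _ then true else false.
Proof.
rewrite inE /lam ptK ?labels_lt //; case: x => [i|v].
  apply: (allP (s := iota 0 8) (a := fun k => nth false octad_word (nth 0 labels k))%N).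
    by vm_compute.
  by rewrite mem_iota ltn_ord.
apply/negbTE; apply: (allP (s := iota 0 16)
  (a := fun k => ~~ nth false octad_word (nth 0 labels (8 + k)))%N).
  by vm_compute.
by rewrite mem_iota code_lt ?size_vbits.
Qed.

Lemma lam_infty : lam (inl ord_max) = None. Proof. by []. Qed.

(** * Gluing a permutation of the octad to an affine map of its complement *)

Section Glue.
Local Open Scope group_scope.
Implicit Types (s t : 'S_8) (M N : {'GL_4['F_2]}) (u v : 'rV['F_2]_4).

Definition glue_fun s M v (p : P1F23) : P1F23 :=
  match lam_inv p with
  | inl i => lam (inl (s i))
  | inr u => lam (inr (u *m GLval M + v)%R)
  end.

Lemma GL_unit M : GLval M \in unitmx. Proof. exact: valP. Qed.

Lemma glue_fun_inj s M v : injective (glue_fun s M v).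
Proof.
move=> p q; rewrite -{2}(lam_invK p) -{2}(lam_invK q) /glue_fun.
case: (lam_inv p) => [i|u]; case: (lam_inv q) => [j|w] /lam_inj[].
- by move/perm_inj->.
- by [].
- by [].
- by move/addIr/(can_inj (mulmxK (GL_unit M)))->.
Qed.

Definition glue s M v : {perm P1F23} := perm (@glue_fun_inj s M v).

Lemma glue_inl s M v i : glue s M v (lam (inl i)) = lam (inl (s i)).
Proof. by rewrite permE /glue_fun lamK. Qed.

Lemma glue_inr s M v u : glue s M v (lam (inr u)) = lam (inr (u *m GLval M + v)%R).
Proof. by rewrite permE /glue_fun lamK. Qed.

Lemma eq_on_labels (g h : {perm P1F23}) :
  (forall x, g (lam x) = h (lam x)) -> g = h.
Proof. by move=> e; apply/permP=> p; rewrite -(lam_invK p). Qed.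

Lemma glueM s t M N v w :
  glue s M v * glue t N w = glue (s * t) (M * N) (v *m GLval N + w)%R.
Proof.
apply: eq_on_labels => -[i|u]; rewrite permM ?glue_inl ?glue_inr ?permM //.
by rewrite GL_ME mulmxDl mulmxA addrA.
Qed.

Lemma glue1 : glue 1 1 0 = 1.
Proof.
apply: eq_on_labels => -[i|u]; rewrite perm1 ?glue_inl ?glue_inr ?perm1 //.
by rewrite GL_1E mulmx1 addr0.
Qed.

Lemma glue_inj s t M N v w : glue s M v = glue t N w -> [/\ s = t, M = N & v = w].
Proof.
move=> e; have eI i : s i = t i.
  by have := glue_inl s M v i; rewrite e glue_inl => /lam_inj[].
have eV u : (u *m GLval M + v = u *m GLval N + w)%R.
  by have := glue_inr s M v u; rewrite e glue_inr => /lam_inj[].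
have evw : v = w by have := eV 0; rewrite !mul0mx !add0r.
split=> //; first exact/permP.
apply: val_inj; apply/row_matrixP=> i; rewrite !rowE.
by have := eV (delta_mx 0 i); rewrite evw => /addIr.
Qed.

End Glue.

Definition bmx (m : seq (seq bool)) : 'M['F_2]_4 :=
  \matrix_(i, j) (nth false (nth [::] m i) j)%:R.

(** Adding to [w] the rows of [m] selected by [b] is an affine map of [b]; thus [enc], written for
    the code, also computes the action on the complement of the octad. *)
Lemma vrow_mul m b w : size m = 4%N -> all (wordn 4) m -> size b = 4%N -> size w = 4%N ->
  vrow (enc m b w) = vrow b *m bmx m + vrow w.
Proof.
move=> sm m4 sb sw; rewrite (enc_additive _ vrow_xor) // addrC; congr (_ + _).
have eb : take (size m) b = b by rewrite take_oversize ?sm ?sb.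
rewrite -{1}eb (sum_zip_take [::] vrow).
rewrite -(big_mkord xpredT (fun i => (nth false b i)%:R *: vrow (nth [::] m i))) sm.
rewrite big_mkord mulmx_sum_row; apply: eq_bigr => i _; rewrite mxE; congr (_ *: _).
by apply/rowP=> j; rewrite !mxE.
Qed.

Definition glue_label (c : seq nat) (m : seq (seq bool)) (w : seq bool) (k : nat) : nat :=
  if (k < 8)%N then nth 0%N c k else (8 + code (enc m (decode (k - 8)) w))%N.

Definition glue_table c m w : seq nat :=
  [seq nth 0 labels (glue_label c m w (index n labels)) | n <- iota 0 24]%N.

Definition glue_check c m w :=
  [&& size m == 4%N, all (wordn 4) m, size w == 4%N &
      all (fun r => codeword (perm_word (glue_table c m w) r)) golay_rows].

Lemma glue_M24 (s : 'S_8) (M : {'GL_4['F_2]}) c m w :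
  (forall i : 'I_8, nth 0%N c i = s i) -> GLval M = bmx m -> glue_check c m w ->
  glue s M (vrow w) \in M24.
Proof.
move=> cE ME /and4P[/eqP sm m4 /eqP sw chk]; apply: table_M24 chk => [|n lt_n|].
- by rewrite size_map size_iota.
- rewrite (nth_map 0%N) ?size_iota // nth_iota // add0n.
  rewrite -[in LHS](lam_invK (pt n)) /lam_inv ptK // /glue_label.
  case: ltnP => [lt8|le8].
    by rewrite glue_inl /lam -cE inordK.
  rewrite glue_inr ME -vrow_mul //.
  by rewrite /lam vrowK // (size_enc (n := 4)).
- by apply/allP=> _ /mapP[n _ ->]; apply: labels_lt.
Qed.

(** * Generation of the alternating group by 3-cycles through two given points *)

Section AltGenerators.
Variables (T : finType) (x y : T).
Hypothesis neq_xy : x != y.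
Local Open Scope group_scope.

(** The transposition [t] inverts each generator of [C], hence normalizes [C]. The product of [C]
    and [<[t]>] contains all transpositions through [x], so it is the whole symmetric group, and its
    even elements lie in [C]. *)
Lemma Alt_sub_3cycles (D : {group {perm T}}) :
  (forall z, z != x -> tperm x y * tperm x z \in D) -> 'Alt_T \subset D.
Proof.
move=> D3; set t := tperm x y.
pose C := [group of <<[set t * tperm x z | z in [pred z | z != x]]>>].
have sCD : C \subset D by rewrite gen_subG; apply/subsetP=> _ /imsetP[z /D3 Dz ->].
have sCA : C \subset 'Alt_T.
  rewrite gen_subG; apply/subsetP=> _ /imsetP[z nz ->]; rewrite inE in nz.
  by rewrite Alt_even odd_permM !odd_tperm neq_xy (eq_sym x) nz.
have memC z : z != x -> t * tperm x z \in C by move=> nz; apply/mem_gen/imset_f.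
have nCt : <[t]> \subset 'N(C).
  rewrite cycle_subG inE /= -genJ gen_subG.
  apply/subsetP=> _ /imsetP[_ /imsetP[z nz ->] ->].
  rewrite conjgE -mulgA mulKg -groupV invMg [t^-1]tpermV tpermV.
  exact: memC.
have eqT : C * <[t]> = setT.
  rewrite -norm_joinEr //; apply/eqP; rewrite -subTset -(gen_tperm x) gen_subG.
  apply/subsetP=> _ /imsetP[z _ ->].
  have Jt : t \in C <*> <[t]> by rewrite mem_gen // inE cycle_id orbT.
  have [->|nz] := eqVneq z x; first by rewrite tperm1 group1.
  rewrite -(groupMl _ Jt) mem_gen // inE memC //.
apply/subsetP=> s As; have : s \in C * <[t]> by rewrite eqT inE.
case/mulsgP=> c u Cc /cycleP[n ->] es; rewrite es groupM ?(subsetP sCD) //.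
have /eqP : odd_perm s = false by apply/negbTE; rewrite -Alt_even.
have -> : t ^+ n = if odd n then t else 1.
  elim: n {es} => //= n IH; rewrite expgS IH; case: (odd n) => /=; rewrite ?mulg1 //.
  exact: tperm2.
rewrite es odd_permM; move: (subsetP sCA _ Cc); rewrite Alt_even => /negbTE->.
have -> : t ^+ n = if odd n then t else 1.
  elim: n {es} => //= n IH; rewrite expgS IH; case: (odd n) => /=; rewrite ?mulg1 //.
  exact: tperm2.
by case: (odd n); rewrite ?group1 //= odd_tperm neq_xy.
Qed.

End AltGenerators.

Section AltToGL.
Local Open Scope group_scope.
Implicit Types (s t : 'S_8) (M N : {'GL_4['F_2]}) (u v : 'rV['F_2]_4).

Lemma vbits0 : vbits 0 = nseq 4 false.
Proof.
apply: (@eq_from_nth _ false); rewrite size_vbits // => j lj.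
by rewrite (nth_vbits _ (Ordinal lj)) mxE nth_nseq lj.
Qed.

(** This is [M24_frame] read through the labels: the octad points of index at least 2, and the zero
    vector, which labels the point 4. *)
Lemma M24_lam_frame (g : {perm P1F23}) : g \in M24 ->
  (forall i : 'I_8, (1 < i)%N -> g (lam (inl i)) = lam (inl i)) ->
  g (lam (inr 0)) = lam (inr 0) -> g = 1.
Proof.
move=> gM fixi fix0; apply: (M24_frame gM) => n n_in.
have : n \in [:: nth 0 labels 8 & [seq nth 0 labels k | k <- iota 2 6]]%N.
  by apply: (allP (s := frame) (a := [in _])) n_in.
rewrite inE => /orP[/eqP-> | /mapP[k k_in ->]].
  by have -> : pt (nth 0 labels 8)%N = lam (inr 0) by rewrite /lam vbits0.
have lt_k : (k < 8)%N by move: k_in; rewrite mem_iota => /andP[].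
have -> : pt (nth 0 labels k)%N = lam (inl (Ordinal lt_k)) by [].
by rewrite fixi //; move: k_in; rewrite mem_iota => /andP[].
Qed.

Lemma glue_frame s M : glue s M 0 \in M24 ->
  (forall i : 'I_8, (1 < i)%N -> s i = i) -> s = 1 /\ M = 1.
Proof.
move=> gM fixs; suff /glue_inj[] : glue s M 0 = glue 1 1 0 by [].
rewrite glue1; apply: (M24_lam_frame gM) => [i lt1i|].
  by rewrite glue_inl fixs.
by rewrite glue_inr mul0mx addr0.
Qed.

(** At most one matrix qualifies, by [glue_uniq], and the default is never reached on A_8, by
    [Alt_glue]. *)
Definition alt_mx s : {'GL_4['F_2]} := odflt 1 [pick M | glue s M 0 \in M24].

Lemma glue_M s t M N : glue s M 0 * glue t N 0 = glue (s * t) (M * N) 0.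
Proof. by rewrite glueM mul0mx addr0. Qed.

Lemma glue_V s M : (glue s M 0)^-1 = glue s^-1 M^-1 0.
Proof. by apply: (mulgI (glue s M 0)); rewrite glue_M !mulgV glue1. Qed.

Lemma glue_uniq s M N : glue s M 0 \in M24 -> glue s N 0 \in M24 -> M = N.
Proof.
move=> gM gN; have : glue 1 (M * N^-1) 0 \in M24.
  by rewrite -(mulgV s) -glue_M -glue_V groupM // groupV.
case/glue_frame=> [i _|_ e]; first by rewrite perm1.
by apply: (mulIg N^-1); rewrite e mulgV.
Qed.

(* The matrices by which the 3-cycles (0 1)(0 i) act on the complement of the
   octad, given by the codes of their rows. *)
Definition cycle_mx (i : nat) : seq (seq bool) := map decode (nth [::]
  [:: [::]; [::]; [:: 8; 5; 15; 9]; [:: 12; 7; 14; 3]; [:: 4; 10; 5; 2];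
      [:: 13; 8; 11; 10]; [:: 5; 13; 1; 11]; [:: 9; 15; 10; 1]]%N i).

Definition nat_tperm (a b k : nat) : nat :=
  if k == a then b else if k == b then a else k.

Definition cycle_tab (i : nat) : seq nat :=
  [seq nat_tperm 0 i (nat_tperm 0 1 k) | k <- iota 0 8].

Lemma nat_tpermE n (a b k : 'I_n) : tperm a b k = nat_tperm a b k :> nat.
Proof.
rewrite /nat_tperm !(inj_eq val_inj).
by case: tpermP => [->|->|/eqP/negbTE-> /eqP/negbTE->//]; rewrite ?eqxx //; case: eqP => [->|].
Qed.

Definition o1 : 'I_8 := @Ordinal 8 1 isT.

Lemma cycle_check : all (fun i => glue_check (cycle_tab i) (cycle_mx i) (nseq 4 false) &&
    all (fun b => xorw (enc (cycle_mx i) (enc (cycle_mx i) b (nseq 4 false)) (nseq 4 false))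
      (enc (cycle_mx i) b (nseq 4 false)) == b) (map decode (iota 0 16))) (iota 2 6).
Proof. by vm_compute. Qed.

Lemma vrow0 : vrow (nseq 4 false) = 0%R.
Proof. by apply/rowP=> j; rewrite !mxE nth_nseq if_same. Qed.

(* [M ^ 2 + M = 1] says that the 3-cycle acts without nonzero fixed vectors, which
   makes all translations commutators. *)
Lemma cycle_glue (i : 'I_8) : (1 < i)%N -> exists M : {'GL_4['F_2]},
  glue (tperm ord0 o1 * tperm ord0 i) M 0 \in M24 /\
  (GLval M *m GLval M + GLval M = 1%:M)%R.
Proof.
move=> lt1i; have i_in : (i : nat) \in iota 2 6 by rewrite mem_iota lt1i ltn_ord.
have /andP[chkM /allP chk2] := allP cycle_check i i_in; set m := cycle_mx i in chkM chk2.
have /and4P[/eqP sm m4 _ _] := chkM.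
(* The relation was evaluated on all 16 vectors; the basis vectors among them give it row by row. *)
have mx2 : (bmx m *m bmx m + bmx m = 1%:M)%R.
  apply/row_matrixP=> j; rewrite !rowE mulmxDr mulmx1 mulmxA.
  set u := delta_mx _ _; have su := size_vbits u.
  have u_in : vbits u \in map decode (iota 0 16).
    apply/mapP; exists (code (vbits u)); last by rewrite decodeK.
    by rewrite mem_iota code_lt.
  have /eqP e := chk2 _ u_in; rewrite -[RHS]vbitsK -e.
  rewrite vrow_xor ?(size_enc (n := 4)) // !vrow_mul ?(size_enc (n := 4)) //.
  by rewrite vrow0 !addr0 vbitsK.
have uM : bmx m \in unitmx.
  have e1 : (bmx m *m (bmx m + 1%:M) = 1%:M)%R by rewrite mulmxDr mulmx1.
  exact: (mulmx1_unit e1).1.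
pose M : {'GL_4['F_2]} := FinRing.Unit uM; exists M; split=> //.
rewrite -vrow0; apply: glue_M24 chkM => // j.
rewrite (nth_map 0%N) ?size_iota // nth_iota // add0n permM.
by rewrite !nat_tpermE.
Qed.

(** The permutations that extend form a group, so it is enough to extend the 3-cycles supplied by
    [cycle_glue]. *)
Lemma Alt_glue s : s \in 'Alt_('I_8) -> exists M, glue s M 0 \in M24.
Proof.
pose D := [set s : 'S_8 | [exists M, glue s M 0 \in M24]].
have gD : group_set D.
  apply/group_setP; split=> [|a b].
    by rewrite inE; apply/existsP; exists 1; rewrite glue1.
  rewrite !inE => /existsP[M gM] /existsP[N gN]; apply/existsP; exists (M * N).
  by rewrite -glue_M groupM.
have sAD : 'Alt_('I_8) \subset Group gD.
  apply: (@Alt_sub_3cycles _ ord0 o1) => // z nz; rewrite inE; apply/existsP.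
  have [z1|lt1] := leqP z 1; last by have [M []] := cycle_glue lt1; exists M.
  exists 1; suff -> : z = o1 by rewrite tperm2 glue1.
  by apply: val_inj => /=; case: z nz z1 => -[|[|k]] //.
by move/(subsetP sAD); rewrite inE => /existsP.
Qed.

Lemma alt_mxP s : s \in 'Alt_('I_8) -> glue s (alt_mx s) 0 \in M24.
Proof. by move/Alt_glue=> [M gM]; rewrite /alt_mx; case: pickP => [//|/(_ M)/idP]. Qed.

Lemma alt_mxM : {in 'Alt_('I_8) &, {morph alt_mx : s t / s * t}}.
Proof.
move=> s t As At; apply: (glue_uniq (s := s * t)); first by rewrite alt_mxP ?groupM.
by rewrite -glue_M groupM ?alt_mxP.
Qed.

Canonical alt_mx_morphism := Morphism alt_mxM.

(** By simplicity of A_8 the kernel is trivial or everything; the latter would give M = 1 for a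
    3-cycle, and M^2 + M = 1 would read 0 = 1. *)
Lemma injm_alt_mx : 'injm alt_mx_morphism.
Proof.
have /simpleP[_ simA] : simple 'Alt_('I_8) by rewrite simple_Alt5 ?card_ord.
case: (simA _ (ker_normal alt_mx_morphism)) => [/= -> // | kerA].
pose i2 := @Ordinal 8 2 isT; have [M [gM M2]] := @cycle_glue i2 isT.
set c := (_ * _) in gM; have Ac : c \in 'Alt_('I_8).
  by rewrite Alt_even odd_permM !odd_tperm.
have M1 : M = 1.
  have c1 : c \in 'ker alt_mx_morphism by rewrite kerA.
  have eM : M = alt_mx_morphism c := glue_uniq gM (alt_mxP Ac).
  by rewrite eM (mker c1).
by move/matrixP/(_ 0 0): M2; rewrite M1 GL_1E mulmx1 !mxE.
Qed.

Lemma SL_F2 n : SL n 'F_2 = [set: {'GL_n['F_2]}].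
Proof.
apply/setP=> u; rewrite !inE; have := valP u; rewrite -[_ \in _]/(GLval u \in unitmx).
by rewrite unitmxE unitfE => nz; rewrite [\det _]F2_boolE nz.
Qed.

(** Surjectivity is a count: both groups have order 20160, checked in the doubled form 8!. *)
Lemma alt_mx_isom : isom 'Alt_('I_8) (SL 4 'F_2) alt_mx_morphism.
Proof.
apply/isomP; split; first exact: injm_alt_mx.
apply: etrans _ (esym (SL_F2 4)); apply/eqP; rewrite eqEcard subsetT card_injm ?injm_alt_mx //.
rewrite card_GL // card_Fp // -(leq_pmul2l (m := 2)) // card_Alt ?card_ord //.
do 4!rewrite big_nat_recr //; rewrite big_geq // (_ : 'C(4, 2) = 6)%N // !factS fact0.
Qed.

End AltToGL.

(** * The stabilizer of a flag *)

Section FlagGroup.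
Local Open Scope group_scope.
Local Notation f := alt_mx_morphism.
Implicit Types (s t : 'S_7) (u v : 'rV['F_2]_4).

Definition translation v : {perm P1F23} := glue 1 1 v.

Lemma translationM : {in [set: 'rV['F_2]_4] &, {morph translation : u v / u * v}}.
Proof.
by move=> u v _ _; rewrite /translation glueM GL_1E mulmx1 !mulg1.
Qed.
Canonical translation_morphism := Morphism translationM.

Definition lift_A7 s : {perm P1F23} := glue (A7_A8 s) (f (A7_A8 s)) 0.

Lemma lift_A7M : {in 'Alt_('I_7) &, {morph lift_A7 : s t / s * t}}.
Proof.
move=> s t As At; rewrite /lift_A7 glue_M -morphM ?A7_A8_Alt //.
by rewrite /A7_A8 lift_permM.
Qed.
Canonical lift_A7_morphism := Morphism lift_A7M.

Lemma translation_lift_A7 : {in [set: 'rV['F_2]_4] & 'Alt_('I_7),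
  morph_act ('MR (A7_repr f))%gact 'J translation_morphism lift_A7_morphism}.
Proof.
move=> v s _ As /=; apply: (mulgI (lift_A7 s)); rewrite -conjgC.
rewrite /translation /lift_A7 !glueM !mul1g !mulg1 GL_1E mulmx1 add0r.
by rewrite addr0 mx_repr_actE.
Qed.

Definition affine_morphism := xsdprod_morphism translation_lift_A7.

Definition G2 := (affine_morphism @* setT)%G.

Lemma G2E : G2 = translation @: setT * lift_A7 @: 'Alt_('I_7) :> {set _}.
Proof.
rewrite /= /affine_morphism im_xsdprodm !morphimEdom //.
Qed.

Lemma G2_isog : G2 \isog [set: affine_A7 f].
Proof.
rewrite isog_sym; apply: (sub_isog (f := affine_morphism)) => //.
rewrite injm_xsdprodm; apply/and3P; split.
- by apply/injmP=> u v _ _ /glue_inj[].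
- apply/injmP=> s t _ _ /glue_inj[/permP e _ _]; apply/permP=> i.
  by have := e (lift ord_max i); rewrite !lift_perm_lift => /lift_inj.
rewrite -subG1; apply/subsetP=> _ /setIP[/morphimP[u _ _ ->] /morphimP[s _ _]].
move/glue_inj=> [_ _ -> /=]; rewrite inE; exact/eqP/glue1.
Qed.

Lemma bmx1 : bmx (map decode [:: 1; 2; 4; 8]%N) = 1%:M.
Proof.
apply/matrixP=> i j; rewrite !mxE; congr (nat_of_bool _)%:R.
rewrite -val_eqE; case: i j => [i li] [j lj] /=.
by case: i li => [|[|[|[|]]]] //; case: j lj => [|[|[|[|]]]].
Qed.

Lemma translation_M24 v : translation v \in M24.
Proof.
have chk : all (fun b => glue_check (iota 0 8) (map decode [:: 1; 2; 4; 8]%N) b)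
   (map decode (iota 0 16)) by vm_compute.
rewrite /translation -[v]vbitsK; apply: (glue_M24 _ _ (allP chk _ _)).
- by move=> i; rewrite perm1 nth_iota ?ltn_ord.
- by rewrite GL_1E bmx1.
apply/mapP; exists (code (vbits v)); last by rewrite decodeK ?size_vbits.
by rewrite mem_iota code_lt ?size_vbits.
Qed.

Lemma lift_A7_M24 s : s \in 'Alt_('I_7) -> lift_A7 s \in M24.
Proof. by move=> As; apply/alt_mxP/A7_A8_Alt. Qed.

Lemma G2_M24 : G2 \subset M24.
Proof.
rewrite G2E mul_subG //; apply/subsetP=> g /imsetP[x xA ->].
  exact: translation_M24.
exact: lift_A7_M24.
Qed.

Definition flag_stab (g : {perm P1F23}) := (g @: octad == octad) && (g None == None).

Lemma flag_stab_mem g p : flag_stab g -> (g p \in octad) = (p \in octad).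
Proof. by case/andP=> /eqP gO _; rewrite -{1}gO mem_imset //; apply: perm_inj. Qed.

Lemma flag_stab_inl g i : flag_stab g -> exists j, g (lam (inl i)) = lam (inl j).
Proof.
move/flag_stab_mem=> gE; have := mem_octad (inl i); rewrite -gE -[g _]lam_invK mem_octad.
by case: (lam_inv _) => // j _; exists j.
Qed.

Lemma flag_stab_inr g u : flag_stab g -> exists v, g (lam (inr u)) = lam (inr v).
Proof.
move/flag_stab_mem=> gE; have := mem_octad (inr u); rewrite -gE -[g _]lam_invK mem_octad.
by case: (lam_inv _) => // v _; exists v.
Qed.

Lemma glue_flag_stab (s : 'S_8) M v : s ord_max = ord_max -> flag_stab (glue s M v).
Proof.
move=> fix_s; rewrite /flag_stab -lam_infty glue_inl fix_s eqxx andbT.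
rewrite eqEcard card_imset ?leqnn ?andbT; last exact: perm_inj.
apply/subsetP=> p /imsetP[q qO ->]; move: qO; rewrite -(lam_invK q).
by case: (lam_inv q) => [i|u]; rewrite ?glue_inl ?glue_inr !mem_octad.
Qed.

Lemma G2_flag_stab g : g \in G2 -> flag_stab g.
Proof.
rewrite G2E => /mulsgP[x y /imsetP[v _ ->] /imsetP[s _ ->] ->].
by rewrite /translation /lift_A7 glueM glue_flag_stab // mul1g lift_perm_id.
Qed.

Lemma translation_G2 v : translation v \in G2.
Proof. by rewrite G2E -[translation v]mulg1 mem_mulg ?imset_f // -(morph1 lift_A7_morphism) imset_f. Qed.

Lemma lift_A7_G2 s : s \in 'Alt_('I_7) -> lift_A7 s \in G2.
Proof.
by move=> As; rewrite G2E -[lift_A7 s]mul1g mem_mulg ?imset_f // -(morph1 translation_morphism) imset_f ?inE.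
Qed.

(** An element [h] of [G2] is built that agrees with [g] on the frame; rigidity then gives
    [g = h]. *)
Lemma flag_stab_G2 g : g \in M24 -> flag_stab g -> g \in G2.
Proof.
move=> gM gF.
have /fin_all_exists[s7 s7E] (i : 'I_7) : exists j : 'I_7,
    g (lam (inl (lift ord_max i))) = lam (inl (lift ord_max j)).
  have [j gj] := flag_stab_inl (lift ord_max i) gF; rewrite gj.
  case: (unliftP ord_max j) => [k ->|ej]; first by exists k.
  have : g (lam (inl (lift ord_max i))) = g (lam (inl ord_max)).
    by rewrite gj ej lam_infty; case/andP: gF => _ /eqP.
  move/perm_inj/lam_inj/(congr1 (fun x => if x is inl k then k else ord0)) => e.
  by have := neq_lift ord_max i; rewrite e eqxx.
have s7_inj : injective s7.
  move=> i j e; have : g (lam (inl (lift ord_max i))) = g (lam (inl (lift ord_max j))).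
    by rewrite !s7E e.
  by move/perm_inj/lam_inj/(congr1 (fun x => if x is inl k then k else ord0))/lift_inj.
pose s := perm s7_inj; have [v gv] := flag_stab_inr 0 gF.
(* The permutation induced on the seven finite octad points is not known to be even. Composing with
   the transposition of the points 0 and 1 corrects its parity without changing it on the frame. *)
pose t := if odd_perm s then tperm ord0 (@Ordinal 7 1 isT) else 1.
have Ats : t * s \in 'Alt_('I_7).
  by rewrite Alt_even odd_permM /t; case: (odd_perm s); rewrite ?odd_tperm ?odd_perm1.
pose h := lift_A7 (t * s) * translation v.
have hG : h \in G2 by apply: groupM; [exact: lift_A7_G2 | exact: translation_G2].
suff -> : g = h by exact: hG.
apply: (mulIg h^-1); rewrite mulgV; apply: M24_lam_frame.
- by apply: groupM gM _; rewrite groupV; apply: (subsetP G2_M24).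
- move=> i lt1i; rewrite permM; apply: (canLR (permK h)); symmetry.
  rewrite /h permM /lift_A7 glue_inl /translation glue_inl perm1.
  case: (unliftP ord_max i) => [k ek|->]; last first.
    by rewrite lift_perm_id lam_infty; case/andP: gF => _ /eqP.
  suff tk : t k = k by rewrite ek s7E /A7_A8 lift_perm_lift permM tk permE.
  have lt1k : (1 < k)%N by move: lt1i; rewrite ek lift_max.
  rewrite /t; case: (odd_perm s); rewrite ?perm1 //.
  by rewrite tpermD // -val_eqE /=; case: (val k) lt1k => [|[]].
rewrite permM gv; apply: (canLR (permK h)); symmetry.
by rewrite /h permM /lift_A7 glue_inr mul0mx addr0 /translation glue_inr mul0mx add0r.
Qed.

End FlagGroup.

Lemma perfect_group_der1 (k : fieldType) (gT : finGroupType) (G : {group gT}) :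
  (G \subset G^`(1))%g -> perfect_group k G.
Proof.
move=> sGG' rG x Gx; have /subsetP sub := rker_linear rG (erefl 1%N).
by have /rkerP[] := sub x (subsetP sGG' x Gx).
Qed.

(** * Perfectness and self-normalization of the flag stabilizer *)

Section G2Theory.
Local Open Scope group_scope.
Local Notation f := alt_mx_morphism.

Lemma Alt_der1 (T : finType) : (4 < #|T|)%N -> ('Alt_T)^`(1) = 'Alt_T.
Proof.
move=> T5; have /simpleP[_ simA] := simple_Alt5 T5.
case: (simA _ (der_normal 1 _)) => // /derG1P/abelian_sol.
by rewrite solvable_AltF.
Qed.

Lemma A7_A8_tperm (a b : 'I_7) : A7_A8 (tperm a b) = tperm (lift ord_max a) (lift ord_max b).
Proof.
apply/permP=> i; rewrite /A7_A8; case: (unliftP ord_max i) => [j|] ->.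
  by rewrite lift_perm_lift inj_tperm //; apply: lift_inj.
by rewrite lift_perm_id tpermD // eq_sym neq_lift.
Qed.

Lemma F2_addmm m n (A : 'M['F_2]_(m, n)) : (A + A)%R = 0%R.
Proof. by rewrite -mulr2n -scaler_nat (_ : 2%:R = 0 :> 'F_2)%R ?scale0r //; apply: val_inj. Qed.

(** The commutator of the translation by [u M] with a 3-cycle of matrix M is the translation by u
    M^2 - u M, which in characteristic 2 is u (M^2 + M) = u. *)
Lemma translation_comm (u : 'rV['F_2]_4) : translation u \in G2^`(1).
Proof.
pose i0 := @Ordinal 7 0 isT; pose j1 := @Ordinal 7 1 isT; pose i2 := @Ordinal 7 2 isT.
pose s : 'S_7 := tperm i0 j1 * tperm i0 i2.
have As : s \in 'Alt_('I_7) by rewrite Alt_even odd_permM !odd_tperm.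
have As8 := A7_A8_Alt As.
have e8 : A7_A8 s = tperm ord0 o1 * tperm ord0 (lift ord_max i2).
  rewrite /A7_A8 -(lift_permM _ ord_max) -/(A7_A8 _) -/(A7_A8 _) !A7_A8_tperm.
  by congr (tperm _ _ * tperm _ _); apply: val_inj.
have [M [gM M2]] := @cycle_glue (lift ord_max i2) isT.
have eM : f (A7_A8 s) = M by rewrite -e8 in gM; apply: glue_uniq (alt_mxP As8) gM.
suff -> : translation u = [~ translation (u *m GLval M)%R, lift_A7 s].
  apply: subsetP (commgSS (subxx _) (subxx _)) _ _.
  by apply: mem_commg; [exact: translation_G2 | exact: lift_A7_G2].
rewrite commgEl; apply: (mulgI (translation (u *m GLval M)%R)); rewrite mulKVg.
apply: (mulgI (lift_A7 s)); rewrite -conjgC /lift_A7 eM /translation !glueM.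
rewrite !mul1g !mulg1 GL_1E !mulmx1 addr0 add0r; congr glue.
rewrite -[in X in _ + X](mulmx1 u) -M2 mulmxDr mulmxA addrCA.
by rewrite -mulmxDr F2_addmm mulmx0 addr0.
Qed.

Lemma G2_der1 : G2 \subset G2^`(1).
Proof.
rewrite {1}G2E mul_subG //; apply/subsetP=> g /imsetP[x xA ->].
  exact: translation_comm.
have : lift_A7 x \in lift_A7_morphism @* ('Alt_('I_7))^`(1).
  by rewrite Alt_der1 ?card_ord // mem_morphim.
rewrite morphim_der // => /(subsetP (dergS _ _)); apply.
by apply/subsetP=> h /morphimP[y Ay _ ->]; apply: lift_A7_G2.
Qed.

Lemma G2_fixed p : (forall g, g \in G2 -> g p = p) -> p = None.
Proof.
rewrite -(lam_invK p); case: (lam_inv p) => [i|u] fixp; last first.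
  have := fixp _ (translation_G2 (const_mx 1%R)); rewrite glue_inr GL_1E mulmx1.
  move/lam_inj=> [/(canRL (addKr _))]; rewrite addNr => /matrixP/(_ 0 0).
  by rewrite !mxE.
case: (unliftP ord_max i) fixp => [j|] -> fixp //.
have [a [b [nja njb nab]]] : exists a b : 'I_7, [/\ j != a, j != b & a != b].
  (* Addition is modulo 7, so [j] and the two witnesses are distinct; the resulting 3-cycle moves
     [j]. *)
  exists (j + 1)%R, (j + 1 + 1)%R.
  by split; rewrite -(inj_eq (addrI (- j)%R)) -?addrA ?addKr ?addNr.
have As : tperm j a * tperm j b \in 'Alt_('I_7).
  by rewrite Alt_even odd_permM !odd_tperm nja njb.
have := fixp _ (lift_A7_G2 As); rewrite glue_inl /A7_A8 lift_perm_lift.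
move/lam_inj/(congr1 (fun x => if x is inl k then k else ord0))/lift_inj.
rewrite permM tpermL tpermD // 1?eq_sym // => /eqP.
by rewrite eq_sym (negPf nja).
Qed.

(** A normalizing element permutes the fixed points and the orbits of [G2]. It fixes infinity, the
    only fixed point; and if it moved an octad point outside, the image of the octad, with 8 points,
    would contain the orbit of all 16 outside points. *)
Lemma G2_selfnormal : 'N_M24(G2) = G2.
Proof.
apply/eqP; rewrite eqEsubset subsetI G2_M24 normG !andbT.
apply/subsetP=> g /setIP[gM gN]; apply: flag_stab_G2 => //.
have conjK p k : k \in G2 -> exists2 k', k' \in G2 & k (g p) = g (k' p).
  move=> kG; exists (k ^ g^-1); first by rewrite memJ_norm // groupV.
  by rewrite conjgE invgK !permM permKV.
have gN0 : g None = None.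
  apply: G2_fixed => k /(conjK None)[k' /G2_flag_stab/andP[_ /eqP k'N] ->].
  by rewrite k'N.
rewrite /flag_stab gN0 eqxx andbT eqEcard card_imset ?leqnn ?andbT; last exact: perm_inj.
apply/subsetP=> p /imsetP[q qO ->]; apply: contraT => gqO.
have [u gq] : exists u, g q = lam (inr u).
  move: gqO; rewrite -(lam_invK (g q)) mem_octad.
  by case: (lam_inv _) => // u _; exists u.
suff : (#|[set lam (inr v) | v : 'rV['F_2]_4]| <= #|g @: octad|)%N.
  rewrite card_imset => [|v w /lam_inj[] //]; rewrite card_imset; last exact: perm_inj.
  by rewrite card_octad card_mx card_Fp.
apply/subset_leq_card/subsetP=> _ /imsetP[v _ ->].
have [k' k'G] := conjK q _ (translation_G2 (v - u)%R).
rewrite gq glue_inr GL_1E mulmx1 addrC subrK => ->.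
by rewrite imset_f // flag_stab_mem ?G2_flag_stab.
Qed.

End G2Theory.

(** * PSL(2, q) on the projective line *)

Lemma det_mx22 (R : comNzRingType) (A : 'M[R]_2) :
  \det A = A 0 0 * A 1 1 - A 0 1 * A 1 0.
Proof.
rewrite (expand_det_row _ 0) !big_ord_recl big_ord0 addr0 /cofactor !det_mx11 !mxE.
rewrite expr0 mul1r expr1 mulN1r mulrN /=.
have l01 : lift ord0 ord0 = 1 :> 'I_2 by apply: val_inj.
have l10 : lift (lift ord0 ord0) 0 = 0 :> 'I_2 by apply: val_inj.
by rewrite l10 l01.
Qed.

Section Moebius.
Variable F : finFieldType.
(* Naming the group keeps unification from unfolding its instances. *)
Let GL2 : finGroupType := {'GL_2[F]}.
Implicit Types (v w : 'rV[F]_2) (p : option F) (M N : GL2).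

Definition row2 (x y : F) : 'rV[F]_2 := \row_j (if j == 0 then x else y).
Definition hom_coord p : 'rV[F]_2 := if p is Some x then row2 x 1 else row2 1 0.
Definition proj_point v : option F := if v 0 1 == 0 then None else Some (v 0 0 / v 0 1).

Lemma row2_eq v w : v 0 0 = w 0 0 -> v 0 1 = w 0 1 -> v = w.
Proof.
move=> e0 e1; apply/rowP=> -[[|[|//]] lj]; last first.
  by rewrite (_ : Ordinal lj = 1) //; apply: val_inj.
by rewrite (_ : Ordinal lj = 0) //; apply: val_inj.
Qed.

Lemma hom_coordK : cancel hom_coord proj_point.
Proof. by case=> [x|]; rewrite /proj_point !mxE /= ?oner_eq0 ?divr1 // eqxx. Qed.

Lemma hom_coord_neq0 p : hom_coord p != 0.
Proof.
apply/eqP; case: p => [x|] /matrixP.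
  by move/(_ 0 1); rewrite !mxE => /eqP; rewrite oner_eq0.
by move/(_ 0 0); rewrite !mxE => /eqP; rewrite oner_eq0.
Qed.

Lemma proj_pointZ k v : k != 0 -> proj_point (k *: v) = proj_point v.
Proof.
move=> nk; rewrite /proj_point !mxE mulf_eq0 (negPf nk) /=.
by case: ifP => // _; rewrite -mulf_div divff ?mul1r.
Qed.

Lemma proj_pointK v : v != 0 -> exists2 k, k != 0 & hom_coord (proj_point v) = k *: v.
Proof.
move=> nv; rewrite /proj_point; case: eqP => [v1|/eqP nv1].
  have nv0 : v 0 0 != 0.
    by apply: contraNneq nv => v0; apply/eqP/row2_eq; rewrite ?v0 ?v1 mxE.
  by exists (v 0 0)^-1; rewrite ?invr_eq0 //; apply: row2_eq; rewrite !mxE /= ?mulVf // v1 mulr0.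
exists (v 0 1)^-1; rewrite ?invr_eq0 //.
by apply: row2_eq; rewrite !mxE /= ?mulVf // mulrC.
Qed.

(** Matrices act on row vectors from the right, to match the left-to-right product of permutations;
    so the entries a, b, c, d give x |-> (a x + c) / (b x + d). *)
Definition moebius_fun M p := proj_point (hom_coord p *m GLval M).

Lemma hom_coord_mul_neq0 M p : hom_coord p *m GLval M != 0.
Proof.
apply: contra (hom_coord_neq0 p) => /eqP e.
by rewrite -(mulmxK (valP M) (hom_coord p)) e mul0mx.
Qed.

Lemma moebius_funM M N p : moebius_fun (M * N)%g p = moebius_fun N (moebius_fun M p).
Proof.
have [k nk e] := proj_pointK (hom_coord_mul_neq0 M p).
by rewrite {2}/moebius_fun /moebius_fun e -scalemxAl proj_pointZ // GL_ME mulmxA.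
Qed.

Lemma moebius_fun1 p : moebius_fun 1%g p = p.
Proof. by rewrite /moebius_fun GL_1E mulmx1 hom_coordK. Qed.

Lemma moebius_fun_inj M : injective (moebius_fun M).
Proof.
apply: (@can_inj _ _ _ (moebius_fun M^-1%g)) => p.
by rewrite -moebius_funM mulgV moebius_fun1.
Qed.

Definition moebius M : {perm option F} := perm (@moebius_fun_inj M).

Lemma moebiusM : {in [set: GL2] &, {morph moebius : M N / (M * N)%g}}.
Proof. by move=> M N _ _; apply/permP=> p; rewrite permM !permE moebius_funM. Qed.
Canonical moebius_morphism := Morphism moebiusM.

Lemma moebiusE M p : moebius M p =
  let: (n, d) := if p is Some x
    then (x * GLval M 0 0 + GLval M 1 0, x * GLval M 0 1 + GLval M 1 1)
    else (GLval M 0 0, GLval M 0 1) in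
  if d == 0 then None else Some (n / d).
Proof.
rewrite permE /moebius_fun /proj_point.
have E (j : 'I_2) : (hom_coord p *m GLval M) 0 j =
    if p is Some x then x * GLval M 0 j + GLval M 1 j else GLval M 0 j.
  rewrite mxE !big_ord_recl big_ord0 addr0 (_ : lift ord0 ord0 = 1); last exact: val_inj.
  by case: p => [x|]; rewrite !mxE /= ?mul1r // mul0r addr0.
by rewrite !E; case: p {E}.
Qed.

Definition mx2 (a b c d : F) : 'M[F]_2 := \matrix_(i, j)
  (if i == 0 then if j == 0 then a else b else if j == 0 then c else d).

Lemma mx2_eq (A B : 'M[F]_2) : A 0 0 = B 0 0 -> A 0 1 = B 0 1 ->
  A 1 0 = B 1 0 -> A 1 1 = B 1 1 -> A = B.
Proof.
move=> e00 e01 e10 e11; apply/matrixP=> i j.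
have ord2 (k : 'I_2) : k = 0 \/ k = 1.
  by case: k => [[|[|//]] lk]; [left | right]; apply: val_inj.
by case: (ord2 i) (ord2 j) => -> [] ->.
Qed.

(** The identity is the default for singular entries, which keeps the definition total; [sl2E]
    covers determinant 1. *)
Definition sl2 (a b c d : F) : GL2 := insubd (1%g : GL2) (mx2 a b c d).

Lemma sl2E a b c d : a * d - b * c = 1 -> GLval (sl2 a b c d) = mx2 a b c d.
Proof.
move=> det1; apply: (insubdK (sT := GL2)).
by rewrite [_ \in _]unitmxE det_mx22 !mxE /= det1 unitr1.
Qed.

Lemma sl2_SL a b c d : a * d - b * c = 1 -> sl2 a b c d \in SL 2 F.
Proof. by move=> det1; rewrite inE sl2E // det_mx22 !mxE /= det1. Qed.

Lemma SL_sl2 M : M \in SL 2 F -> exists a b c d,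
  a * d - b * c = 1 /\ M = sl2 a b c d.
Proof.
rewrite inE det_mx22 => /eqP det1.
exists (GLval M 0 0), (GLval M 0 1), (GLval M 1 0), (GLval M 1 1); split=> //.
by apply: val_inj; rewrite /= sl2E //; apply: mx2_eq; rewrite !mxE.
Qed.

Lemma sl2M a b c d a' b' c' d' : a * d - b * c = 1 -> a' * d' - b' * c' = 1 ->
  (sl2 a b c d * sl2 a' b' c' d')%g =
    sl2 (a * a' + b * c') (a * b' + b * d') (c * a' + d * c') (c * b' + d * d').
Proof.
move=> det1 det1'; apply: val_inj; rewrite [LHS]GL_ME /= !sl2E //; last first.
  by rewrite -[RHS]mulr1 -{1}det1 -det1'; ring.
by apply: mx2_eq; rewrite !mxE !big_ord_recl big_ord0 !mxE /= addr0.
Qed.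

Lemma moebius_sl2 a b c d p : a * d - b * c = 1 -> moebius (sl2 a b c d) p =
  let: (n, e) := if p is Some x then (x * a + c, x * b + d) else (a, b) in
  if e == 0 then None else Some (n / e).
Proof. by move=> det1; rewrite moebiusE sl2E // !mxE. Qed.

Definition transl2 t := sl2 1 0 t 1.
Definition weyl2 := sl2 0 1 (-1) 0.

Lemma transl2_det t : 1 * 1 - 0 * t = 1 :> F. Proof. by rewrite mul0r subr0 mulr1. Qed.
Lemma weyl2_det : 0 * 0 - 1 * (-1) = 1 :> F. Proof. by rewrite mul0r sub0r mul1r opprK. Qed.

(** Conjugation by the Weyl element yields the upper unipotents. If b is nonzero, the matrix is a
    product lower * upper * lower; if b = 0, multiplying by the Weyl element puts a, which is
    nonzero, in its place. *)
Lemma SL_generated (H : {group GL2}) :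
  (forall t, transl2 t \in H) -> weyl2 \in H -> SL_group 2 F \subset H.
Proof.
have HM (x y z : GL2) : x \in H -> y \in H -> z \in H -> (x * y * z)%g \in H.
  by move=> Hx Hy Hz; rewrite !groupM.
have HV (x : GL2) : x \in H -> (x^-1)%g \in H by rewrite groupV.
move=> Ht Hw; have Hl b : sl2 1 b 0 1 \in H.
  suff -> : sl2 1 b 0 1 = (weyl2^-1 * transl2 (- b) * weyl2)%g.
    exact: (HM _ _ _ (HV _ Hw) (Ht _) Hw).
  apply: (mulgI weyl2); rewrite -mulgA mulKVg.
  by rewrite !sl2M ?transl2_det ?weyl2_det ?mul0r ?mulr0 ?mulr1 ?subr0 //; congr sl2; ring.
have Hb a b c d : a * d - b * c = 1 -> b != 0 -> sl2 a b c d \in H.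
  move=> det1 nb; pose y := (a - 1) / b; pose x := (d - 1) / b.
  suff -> : sl2 a b c d = (transl2 x * sl2 1%R b 0%R 1%R * transl2 y)%g.
    exact: (HM _ _ _ (Ht x) (Hl b) (Ht y)).
  have -> : c = (a * d - 1) / b by rewrite -det1 opprB addrC subrK mulrAC mulfV ?mul1r.
  have det2 : 1 * 1 - b * 0 = 1 :> F by rewrite mulr0 subr0 mulr1.
  rewrite sl2M ?transl2_det // sl2M ?transl2_det //; last by rewrite /x; field.
  by rewrite /x /y; congr sl2; field.
apply/subsetP=> M /SL_sl2[a [b [c [d [det1 ->]]]]].
have [b0|nb] := eqVneq b 0; last exact: Hb.
rewrite b0 in det1 *; rewrite -(groupMr _ Hw) sl2M ?weyl2_det // Hb //.
  by transitivity (a * d - 0 * c); first by ring.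
apply: contraTneq (oner_neq0 F) => e; rewrite negbK -det1.
by rewrite mulr1 mul0r addr0 in e; rewrite e !mul0r subr0.
Qed.

End Moebius.

(** * Kernel of the Moebius action, perfectness and the stabilizer of infinity *)

Section SpecialLinear.
Variable F : finFieldType.
Let GL2 : finGroupType := {'GL_2[F]}.
Local Notation SL2 := (SL_group 2 F).
Implicit Types (M N : GL2) (a b c d s t : F).

Lemma sl2_inj a b c d a' b' c' d' : a * d - b * c = 1 -> a' * d' - b' * c' = 1 ->
  sl2 a b c d = sl2 a' b' c' d' -> [/\ a = a', b = b', c = c' & d = d'].
Proof.
move=> det1 det1' /(congr1 (fun M => GLval M)); rewrite !sl2E // => /matrixP e.
by split; [have := e 0 0 | have := e 0 1 | have := e 1 0 | have := e 1 1]; rewrite !mxE.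
Qed.

Lemma moebius_sl2_scalar a p : a * a = 1 -> moebius (sl2 a 0 0 a) p = p.
Proof.
move=> a2; rewrite moebius_sl2 ?mulr0 ?subr0 //.
have na : a != 0 by apply: contra_eq_neq a2 => ->; rewrite mulr0 eq_sym oner_eq0.
by case: p => [x|]; rewrite ?eqxx // addr0 mulr0 add0r (negPf na) mulfK.
Qed.

Lemma moebius_fix_scalar a b c d : a * d - b * c = 1 ->
  (forall p, moebius (sl2 a b c d) p = p) -> [/\ b = 0, c = 0 & d = a].
Proof.
move=> det1 fixp; have b0 : b = 0.
  by have := fixp None; rewrite moebius_sl2 //; case: eqP.
have nd : d != 0.
  by apply: contra_eq_neq det1 => ->; rewrite b0 mulr0 mul0r subr0 eq_sym oner_eq0.
have c0 : c = 0.
  have := fixp (Some 0); rewrite moebius_sl2 // b0 !mul0r !add0r (negPf nd) => -[/eqP].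
  by rewrite mulf_eq0 invr_eq0 (negPf nd) orbF => /eqP.
split=> //; have := fixp (Some 1); rewrite moebius_sl2 // b0 c0 !mul1r add0r addr0.
by rewrite (negPf nd) => -[/(canRL (mulfVK nd))]; rewrite mul1r.
Qed.

(** Both sides consist of the scalars of determinant 1: fixing infinity, 0 and 1 forces a scalar
    matrix, and so does commuting with one lower and one upper elementary matrix. *)
Lemma moebius_kernel : ('ker_SL2 (@moebius_morphism F) = 'Z(SL2))%g.
Proof.
apply/setP=> M; rewrite in_setI [in RHS]in_setI.
case: (boolP (M \in _)) => // SLM; rewrite !andTb inE in_setT andTb inE.
have [a [b [c [d [det1 eM]]]]] := SL_sl2 SLM.
apply/set1P/centP=> [kM N _|cM].
  have [b0 c0 d0] : [/\ b = 0, c = 0 & d = a].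
    by apply: moebius_fix_scalar => // p; rewrite -eM kM perm1.
  have eaM : GLval M = a%:M.
    by rewrite eM sl2E //; apply: mx2_eq; rewrite !mxE /= ?b0 ?c0 ?d0 // mulr0n.
  by apply: val_inj; rewrite -![val _]/(GLval _) !GL_ME eaM; apply/esym/scalar_mxC.
have det_l : 1 * 1 - 1 * 0 = 1 :> F by rewrite mulr0 subr0 mulr1.
have [b0 d0] : b = 0 /\ d = a.
  have := cM _ (sl2_SL (transl2_det 1)); rewrite /commute eM !sl2M ?transl2_det //.
  rewrite !mul1r !mul0r !mulr1 !mulr0 !addr0 !add0r => /sl2_inj[||/eqP].
  - by rewrite -det1; ring.
  - by rewrite -det1; ring.
  by rewrite -subr_eq0 addrAC subrr add0r => /eqP-> _ /eqP; rewrite addrC (inj_eq (addIr _)) => /eqP.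
have c0 : c = 0.
  have := cM _ (sl2_SL det_l); rewrite /commute eM !sl2M //.
  rewrite !mul1r !mul0r !mulr1 !mulr0 !addr0 !add0r => /sl2_inj[||/eqP].
  - by rewrite -det1; ring.
  - by rewrite -det1; ring.
  by rewrite -subr_eq0 opprD addrA subrr add0r oppr_eq0 => /eqP.
apply/permP=> p; rewrite perm1 eM b0 c0 d0; apply: moebius_sl2_scalar.
by rewrite -det1 b0 d0 mul0r subr0.
Qed.

Definition PSL_perm : {group {perm option F}} := (@moebius_morphism F @* SL2)%G.

Lemma PSL_perm_isog : PSL_perm \isog PSL 2 F.
Proof.
rewrite isog_sym; have := first_isog_loc (@moebius_morphism F) (subsetT SL2).
by rewrite moebius_kernel.
Qed.

Lemma mem_PSL_perm a b c d : a * d - b * c = 1 -> moebius (sl2 a b c d) \in PSL_perm.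
Proof. by move=> det1; apply: (mem_morphim (moebius_morphism F)); [rewrite inE | exact: sl2_SL]. Qed.

Lemma PSL_permP g : g \in PSL_perm -> exists a b c d,
  a * d - b * c = 1 /\ g = moebius (sl2 a b c d).
Proof. by case/morphimP=> M _ /SL_sl2[a [b [c [d [? ->]]]]] ->; exists a, b, c, d. Qed.

Lemma PSL_perm_generated (H : {group {perm option F}}) :
  (forall t, moebius (transl2 t) \in H) -> moebius (weyl2 F) \in H ->
  PSL_perm \subset H.
Proof.
move=> Ht Hw; rewrite sub_morphim_pre ?subsetT //.
by apply: SL_generated => [t|]; apply/morphpreP; split; rewrite ?in_setT //; apply: Ht.
Qed.

(** Conjugation by diag(a, 1/a) multiplies the parameter of a lower unipotent by a^2, so the
    commutator has parameter s (a^2 - 1). *)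
Lemma transl2_der1 a t : a != 0 -> a * a != 1 -> transl2 t \in (SL2^`(1))%g.
Proof.
move=> na na2; pose s := t / (a * a - 1); pose D : GL2 := sl2 a 0 0 a^-1.
have detD : a * a^-1 - 0 * 0 = 1 by rewrite mulfV // mulr0 subr0.
suff -> : transl2 t = [~ transl2 s, D]%g.
  by apply: mem_commg; apply: sl2_SL; rewrite ?transl2_det.
apply: (mulgI (transl2 s)); rewrite commgEl mulKVg; apply: (mulgI D); rewrite -conjgC.
have nb : a * a - 1 != 0 by rewrite subr_eq0.
rewrite !sl2M ?transl2_det //; last by rewrite /s; field.
by rewrite /s; congr sl2; field; rewrite ?na ?nb.
Qed.

Lemma PSL_perm_der1 a : a != 0 -> a * a != 1 -> (PSL_perm \subset PSL_perm^`(1))%g.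
Proof.
move=> na na2; rewrite -morphim_der ?subsetT // morphimS //.
apply: SL_generated => [t|]; first exact: transl2_der1 na na2.
have det_l : 1 * 1 - 1 * 0 = 1 :> F by rewrite mulr0 subr0 mulr1.
have nW : weyl2 F \in ('N(SL2^`(1)))%g.
  by apply: (subsetP (der_norm 1 _)); apply/sl2_SL/weyl2_det.
have Hl : (transl2 (-1) ^ weyl2 F \in SL2^`(1))%g.
  by rewrite memJ_norm //; apply: transl2_der1 na na2.
have eL : (transl2 (-1) ^ weyl2 F)%g = sl2 1 1 0 1.
  apply: (mulgI (weyl2 F)); rewrite -conjgC !sl2M ?transl2_det ?weyl2_det //.
  by congr sl2; ring.
have -> : weyl2 F = (transl2 (-1)%R * (transl2 (-1)%R ^ weyl2 F) * transl2 (-1)%R)%g.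
  rewrite eL sl2M ?transl2_det // sl2M ?transl2_det //; last by ring.
  by congr sl2; ring.
have HU := transl2_der1 (-1) na na2; exact: groupM (groupM HU Hl) HU.
Qed.

Lemma moebius_transl2 (t : F) p :
  moebius (transl2 t) p = if p is Some x then Some (x + t) else None.
Proof.
rewrite moebius_sl2 ?transl2_det //; case: p => [x|]; last by rewrite eqxx.
by rewrite mulr0 add0r oner_eq0 mulr1 divr1.
Qed.

Lemma moebius_weyl2 p : moebius (weyl2 F) p =
  if p is Some x then if x == 0 then None else Some (- x^-1) else Some 0.
Proof.
rewrite moebius_sl2 ?weyl2_det //; case: p => [x|]; last by rewrite oner_eq0 mul0r.
by rewrite mulr0 add0r mulr1 addr0 mulN1r.
Qed.

Lemma PSL_perm_transitive q : exists2 g, g \in PSL_perm & g q = None.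
Proof.
case: q => [x|]; last by exists 1%g; rewrite ?perm1.
exists (moebius (transl2 (- x)) * moebius (weyl2 F))%g.
  by apply: groupM; apply: mem_PSL_perm; rewrite ?transl2_det ?weyl2_det.
by rewrite permM moebius_transl2 addrN moebius_weyl2 eqxx.
Qed.

Lemma PSL_perm_affine (a c : F) : a != 0 -> exists2 g : {perm option F}, g \in PSL_perm &
  g None = None /\ forall x, g (Some x) = Some (a * a * x + c).
Proof.
move=> na; have det1 : a * a^-1 - 0 * (a^-1 * c) = 1 by rewrite mul0r subr0 mulfV.
exists (moebius (sl2 a 0 (a^-1 * c) a^-1)); first exact: mem_PSL_perm.
split=> [|x]; rewrite moebius_sl2 // ?eqxx // mulr0 add0r invr_eq0 (negPf na) invrK.
by congr Some; field.
Qed.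

Lemma PSL_perm_fix_infty g : g \in PSL_perm -> g None = None ->
  exists a c : F, a != 0 /\ forall x, g (Some x) = Some (a * a * x + c).
Proof.
case/PSL_permP=> a [b [c [d [det1 ->]]]]; rewrite moebius_sl2 //.
case: eqP => // b0 _; rewrite b0 mul0r subr0 in det1.
have na : a != 0 by apply: contra_eq_neq det1 => ->; rewrite mul0r eq_sym oner_eq0.
have ed : d = a^-1 by apply: (mulfI na); rewrite det1 mulfV.
exists a, (a * c); split=> // x.
rewrite moebius_sl2 b0 ?mul0r ?subr0 // mulr0 add0r ed invr_eq0 (negPf na) invrK.
by congr Some; ring.
Qed.

End SpecialLinear.

(** * The exact factorization *)

Definition G1 : {group {perm P1F23}} := PSL_perm 'F_23.

Lemma pt_modn n : pt (n %% 23) = Some n%:R.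
Proof.
by rewrite /pt ltn_pmod //; congr Some; apply: val_inj; rewrite /= !val_F23 modn_mod.
Qed.

Lemma F23_nat (x : 'F_23) : x = (x : nat)%:R.
Proof. by apply: val_inj; rewrite /= val_F23 modn_small ?F23_lt. Qed.

Definition transl_table (t : nat) : seq nat := rcons [seq (n + t) %% 23 | n <- iota 0 23]%N 23.
(** Since 22 is -1 modulo 23, [find] computes -1/n; the two ends exchange 0 and infinity. *)
Definition weyl_table : seq nat :=
  23 :: rcons [seq find (fun m => (m * n) %% 23 == 22) (iota 0 23) | n <- iota 1 22]%N 0%N.

Lemma transl_table_check :
  all (fun t => all (fun r => codeword (perm_word (transl_table t) r)) golay_rows) (iota 0 23).
Proof. by vm_compute. Qed.

Lemma transl2_M24 t : moebius (transl2 t) \in M24.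
Proof.
have t_in : (t : nat) \in iota 0 23 by rewrite mem_iota F23_lt.
apply: (table_M24 (t := transl_table t)) (allP transl_table_check _ t_in).
- by rewrite size_rcons size_map size_iota.
- move=> n; rewrite ltnS leq_eqVlt moebius_transl2 nth_rcons size_map size_iota.
  case/orP=> [/eqP->|lt_n]; first by rewrite ltnn eqxx.
  rewrite lt_n (nth_map 0%N) ?size_iota // nth_iota // add0n pt_modn {1}/pt lt_n.
  by rewrite natrD -F23_nat.
- rewrite all_rcons; apply/andP; split=> //; apply/allP=> _ /mapP[n _ ->].
  by rewrite ltnS ltnW // ltn_pmod.
Qed.

Lemma weyl_table_check : all (fun r => codeword (perm_word weyl_table r)) golay_rows.
Proof. by vm_compute. Qed.

Lemma weyl_tableP n : (0 < n < 23)%N ->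
  (nth 0 weyl_table n < 23)%N /\ ((nth 0 weyl_table n * n) %% 23 = 22)%N.
Proof.
move=> n23; have chk : all (fun n => (nth 0 weyl_table n < 23) &&
  ((nth 0 weyl_table n * n) %% 23 == 22))%N (iota 1 22) by vm_compute.
have n_in : n \in iota 1 22 by rewrite mem_iota.
by case/andP: (allP chk n n_in) => -> /eqP.
Qed.

Lemma weyl2_M24 : moebius (weyl2 'F_23) \in M24.
Proof.
apply: (table_M24 _ _ _ weyl_table_check) => //.
move=> n; rewrite ltnS leq_eqVlt moebius_weyl2 => /orP[/eqP->//|lt_n].
have [->//|n0] := posnP n.
have n23 : (0 < n < 23)%N by rewrite n0.
have [lt_m e] := weyl_tableP n23.
rewrite {1}/pt lt_n; set m := nth _ _ _ in e lt_m *.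
have nz : (n%:R : 'F_23) != 0.
  by rewrite -val_eqE /= val_F23 modn_small // -lt0n.
rewrite (negPf nz) /pt lt_m; congr Some; apply: (mulIf nz).
rewrite mulNr mulVf // -natrM; apply: val_inj.
by rewrite /= val_F23 e.
Qed.

Lemma G1_M24 : G1 \subset M24.
Proof. exact: PSL_perm_generated transl2_M24 weyl2_M24. Qed.

Lemma G1_perfect : (G1 \subset G1^`(1))%g.
Proof. exact: (@PSL_perm_der1 _ 2%:R). Qed.


Lemma ix_Some (x : 'F_23) : ix (Some x) = x. Proof. by []. Qed.

Lemma val_affine (a x c : 'F_23) :
  (a * x + c : 'F_23) = ((a * x + c) %% 23)%N :> nat.
Proof.
by rewrite {1}[a]F23_nat {1}[x]F23_nat {1}[c]F23_nat -natrM -natrD val_F23.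
Qed.

Lemma affine_octad_check : all (fun a => all (fun c =>
    all (fun x => nth false octad_word x ==> nth false octad_word ((a * x + c) %% 23))
      (iota 0 23) ==> (a == 1) && (c == 0))
  (iota 0 23)) squares23%N.
Proof. by vm_compute. Qed.

Lemma square23P (a : 'F_23) : a != 0 -> nat_of_ord (a * a) \in squares23.
Proof.
move=> na; have chk : all (fun a => (a * a) %% 23 \in squares23)%N (iota 1 22) by vm_compute.
rewrite -[a * a]addr0 val_affine addn0; apply: (allP chk).
by rewrite mem_iota lt0n F23_lt andbT.
Qed.

Lemma squares23_root s : s \in squares23 -> exists2 a : 'F_23, a != 0 & a * a = s%:R.
Proof.
move=> s_in; have chk : all (fun s => has (fun a => (a * a) %% 23 == s %% 23)%N (iota 1 22))
  squares23 by vm_compute.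
have /hasP[a] := allP chk s s_in; rewrite mem_iota => /andP[a0 a23] /eqP e.
exists a%:R; first by rewrite -val_eqE /= val_F23 modn_small // -lt0n.
by rewrite -natrM; apply: val_inj; rewrite /= !val_F23.
Qed.

(** Fixing infinity makes [g] affine with square multiplier, and [affine_octad_check] finds only the
    identity among these 253 maps to preserve the octad. *)
Lemma G1_flag_stab g : g \in G1 -> flag_stab g -> g = 1%g.
Proof.
move=> gG gF; have /andP[_ /eqP gN] := gF.
have [a [c [na gE]]] := PSL_perm_fix_infty gG gN.
have c_in : (c : nat) \in iota 0 23 by rewrite mem_iota F23_lt.
have /implyP H := allP (allP affine_octad_check _ (square23P na)) _ c_in.
have /andP[/eqP a1 /eqP c0] : ((a * a : 'F_23) == 1%N :> nat) && ((c : nat) == 0%N).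
  apply: H; apply/allP=> x; rewrite mem_iota => /andP[_ lt_x]; apply/implyP=> xO.
  have : Some (x%:R : 'F_23) \in octad by rewrite inE ix_Some val_F23 modn_small.
  rewrite -(flag_stab_mem _ gF) gE inE ix_Some val_affine val_F23.
  by rewrite (modn_small lt_x).
have a2 : a * a = 1 by apply: val_inj.
have c00 : c = 0 by apply: val_inj.
apply/permP=> -[x|]; rewrite perm1 ?gN //.
by rewrite gE a2 c00 mul1r addr0.
Qed.

Lemma affine_word_octad (C : {set P1F23}) s c : s \in squares23 ->
  bits C = affine_word s c -> exists2 g, g \in G1 & g None = None /\ g @: C \subset octad.
Proof.
move=> s_in bC; have [a na a2] := squares23_root s_in.
have [g gG [gN gE]] := PSL_perm_affine (c%:R : 'F_23) na.
exists g => //; split=> //; apply/subsetP=> _ /imsetP[p Cp ->].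
case: p Cp => [x|]; last by rewrite gN inE.
rewrite -nth_bits_ix bC (nth_map 0%N) ?size_iota ?ix_lt // nth_iota ?ix_lt // add0n ix_Some.
rewrite ltn_eqF ?F23_lt //= gE inE ix_Some a2 val_affine !val_F23.
by rewrite -(modnDm _ (c %% 23)) modnMml modn_mod modnDm.
Qed.

Lemma M24_factorization : (G1 * G2)%g = M24.
Proof.
apply/eqP; rewrite eqEsubset mul_subG ?G1_M24 ?G2_M24 //=.
apply/subsetP=> g gM; have gVM : (g^-1)%g \in M24 by rewrite groupV.
(* The flag moved by the inverse of [g] is brought back inside [G1]: [k1] returns its point to
   infinity, and [k2], fixing infinity, returns its octad. *)
have [k1 k1G k1N] := PSL_perm_transitive (g^-1%g None).
pose C := (g^-1 * k1)%g @: octad.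
have k1M := subsetP G1_M24 _ k1G.
have CM : charvec C \in golay by apply: (M24P _ (groupM gVM k1M)) octad_golay.
have C8 : #|C| = 8 by rewrite card_imset ?card_octad //; apply: perm_inj.
have NC : None \in C.
  by apply/imsetP; exists None; rewrite ?inE // permM k1N.
have [C0|[_ /(_ C8 NC)[s [c [s_in _ bC]]]]] := golay_word_cases CM.
  by rewrite C0 inE in NC.
have [k2 k2G [k2N k2C]] := affine_word_octad s_in bC.
have k2C' : k2 @: C = octad.
  apply/eqP; rewrite eqEcard k2C card_octad card_imset ?C8 //; exact: perm_inj.
pose k := (k1 * k2)%g; have kG : k \in G1 by apply: groupM.
rewrite -(mulKVg k g) mem_mulg // -groupV invMg invgK.
have kM := subsetP G1_M24 _ kG.
apply: flag_stab_G2; first by rewrite groupM.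
apply/andP; split; last by rewrite /k mulgA !permM k1N k2N.
apply/eqP; rewrite -[RHS]k2C' /C -imset_comp; apply: eq_imset => p /=.
by rewrite !permM.
Qed.

Lemma M24_exact : exact_factorization M24 G1 G2.
Proof.
split; first exact: M24_factorization.
apply/trivgP/subsetP=> g /setIP[gG1 /G2_flag_stab gF].
by rewrite inE; apply/eqP/G1_flag_stab.
Qed.

(** * The normalizer of PSL(2, 23) *)

Section G1Normalizer.
Local Open Scope group_scope.

Definition shift : {perm P1F23} := moebius (transl2 1%R).

Lemma shift_None n : (shift ^+ n) None = None.
Proof. by elim: n => [|n IH]; rewrite ?perm1 // expgSr permM IH moebius_transl2. Qed.

Lemma shift_Some n x : (shift ^+ n) (Some x) = Some (x + n%:R)%R.
Proof.
elim: n => [|n IH]; first by rewrite perm1 addr0.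
by rewrite expgSr permM IH moebius_transl2 -addrA natr1.
Qed.

Lemma order_shift : #[shift] = 23.
Proof.
apply: nt_prime_order => //; last first.
  by apply/eqP=> /(congr1 (fun g : {perm P1F23} => g (Some 0%R))); rewrite (shift_Some 1) perm1.
apply/permP=> -[x|]; rewrite ?shift_None ?shift_Some perm1 //.
have e23 : (23%:R = 0 :> 'F_23)%R by apply: val_inj; apply: etrans (val_F23 23) _.
by rewrite e23 addr0.
Qed.

Lemma logn_fact_small p n : prime p -> (n < p)%N -> logn p n`! = 0.
Proof.
move=> p_pr; elim: n => [|n IH] lt_n; first by rewrite logn1.
by rewrite factS lognM ?fact_gt0 // IH ?(ltnW lt_n) // addn0 lognE p_pr /= gtnNdvd.
Qed.

(** The square of 23 does not divide 24!, the order of the full symmetric group on the points. *)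
Lemma shift_Sylow : 23.-Sylow(G1) <[shift]>.
Proof.
have sTG : <[shift]> \subset G1.
  by rewrite cycle_subG; apply/mem_PSL_perm/transl2_det.
rewrite pHallE sTG p_part [#|_|]order_shift.
suff -> : logn 23 #|G1| = 1%N by [].
apply/eqP; rewrite eqn_leq; apply/andP; split.
  apply: leq_trans (_ : logn 23 24`! <= _)%N; last first.
    by rewrite (factS 23) (factS 22) !lognM ?fact_gt0 // logn_fact_small // addn0 logn_prime.
  apply: dvdn_leq_log; first exact: fact_gt0.
  have <- : #|'Sym_P1F23| = 24`! by rewrite card_Sym card_option card_Fp.
  exact/cardSg/subsetT.
apply: leq_trans (_ : logn 23 23 <= _)%N; first by rewrite logn_prime.
apply: dvdn_leq_log; first exact: cardG_gt0.
by have := cardSg sTG; rewrite [#|<[_]>|]order_shift.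
Qed.

Lemma nonresidue_check : all (fun k => has (fun r =>
    ~~ codeword (perm_word (rcons [seq (k * n) %% 23 | n <- iota 0 23]%N 23) r)) golay_rows)
  nonresidues23.
Proof. by vm_compute. Qed.

Lemma dilation_M24 (g : {perm P1F23}) (k : 'F_23) : g \in M24 ->
  g None = None -> (forall x, g (Some x) = Some (k * x)%R) -> exists a, k = (a ^+ 2)%R.
Proof.
move=> gM gN gE; case: (boolP [exists a, k == (a ^+ 2)%R]) => [/existsP[a /eqP]|nk].
  by exists a.
rewrite nonresidue23P in nk; have /hasP[r r_in] := allP nonresidue_check _ nk.
case/negP; set t := rcons _ _; rewrite -wvec_golay; last first.
  by rewrite size_map size_rcons size_map size_iota.
suff -> : wvec (perm_word t r) = charvec (g^-1 @: set_of_word r).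
  apply: (M24P _ _); first by rewrite groupV.
  rewrite charvec_bits bits_set_of_word; last exact: size_golay_row.
  exact: golay_row_golay.
apply/ffunP=> p; rewrite !ffunE; congr (nat_of_bool _)%:R.
rewrite -{2}(permK g p) mem_imset; last exact: perm_inj.
rewrite inE (nth_map 0%N) ?size_rcons ?size_map ?size_iota ?ix_lt //.
congr nth; case: p => [x|]; rewrite nth_rcons size_map size_iota; last by rewrite gN.
by rewrite gE !ix_Some F23_lt (nth_map 0%N) ?size_iota ?F23_lt // nth_iota ?F23_lt.
Qed.

(** Infinity is the only fixed point of [shift], so [n] fixes it; conjugating [shift] to its k-th
    power makes [n] the map x |-> k x + c. Removing the translation leaves a dilation in M_24, so k
    is a square and [n] is a Moebius map of determinant 1. *)
Lemma normalizer_shift n : n \in M24 -> n \in 'N(<[shift]>) -> n \in G1.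
Proof.
move=> nM nN; have /cycleP[k ek] : shift ^ n \in <[shift]>.
  by rewrite memJ_norm ?cycle_id.
have conjE p : n (shift p) = (shift ^+ k) (n p).
  by rewrite -ek conjgE !permM permK.
have nN0 : n None = None.
  have e := conjE None; rewrite (shift_None 1) in e.
  case En : (n None) e => [x|//]; rewrite shift_Some => -[/eqP].
  rewrite -subr_eq0 opprD addrA subrr add0r oppr_eq0 => /eqP k0.
  have shift_k p : (shift ^+ k) p = p.
    by case: p => [y|]; rewrite ?shift_None ?shift_Some ?k0 ?addr0.
  have := conjE (Some 0%R); rewrite shift_k => /perm_inj.
  by rewrite (shift_Some 1).
have [c ec] : exists c, n (Some 0%R) = Some c.
  case En : (n (Some 0%R)) => [c|]; first by exists c.
  by rewrite -nN0 in En; move/perm_inj: En.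
have nE x : n (Some x) = Some (k%:R * x + c)%R.
  rewrite [x]F23_nat; elim: (x : nat) => [|m IH]; first by rewrite mulr0 add0r.
  rewrite -natr1 -[Some _](shift_Some 1) conjE IH shift_Some.
  by congr Some; rewrite mulrDr mulr1 addrAC.
have sM : shift \in M24 by apply: transl2_M24.
(* The exponent is the residue [-c] read as a natural number. *)
have [|||a ea] := @dilation_M24 (n * shift ^+ (- c)%R) k%:R.
- by rewrite groupM ?groupX.
- by rewrite permM nN0 shift_None.
- by move=> x; rewrite permM nE shift_Some -F23_nat addrK.
have na : a != 0%R.
  apply: contraTneq (oner_neq0 'F_23) => a0; rewrite negbK.
  have : n (Some 1%R) = n (Some 0%R) by rewrite !nE ea a0 !mulr0 mulr1 expr0n.
  by move/perm_inj/Some_inj->.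
have [g gG [gN gE]] := PSL_perm_affine c na.
suff -> : n = g by [].
by apply/permP=> -[x|]; rewrite ?nN0 ?gN // nE gE ea.
Qed.

Lemma G1_selfnormal : 'N_M24(G1) = G1.
Proof.
apply/eqP; rewrite eqEsubset subsetI G1_M24 normG !andbT.
have nG1 : G1 <| 'N_M24(G1) by rewrite normalSG ?G1_M24.
have <- : G1 * 'N_('N_M24(G1))(<[shift]>) = 'N_M24(G1) := Frattini_arg nG1 shift_Sylow.
by rewrite mul_subG //; apply/subsetP=> n /setIP[/setIP[nM _] nN]; apply: normalizer_shift.
Qed.

End G1Normalizer.

Theorem theorem3p1 (R : realType) :
  exists G1 G2 : {group {perm P1F23}},
    [/\ G1 \subset M24, G2 \subset M24, G1 \isog PSL 2 'F_23 &
        exists2 f : {morphism 'Alt_('I_8) >-> {'GL_4['F_2]}},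
          isom 'Alt_('I_8) (SL 4 'F_2) f & G2 \isog [set: affine_A7 f]] /\
    [/\ perfect_group R[i] G1 /\ perfect_group R[i] G2,
        ('N_M24(G1) = G1)%g /\ ('N_M24(G2) = G2)%g &
        exists e : exact_factorization M24 G1 G2,
          biperfect (bicrossproduct R[i] e)].
Proof.
have pG1 : perfect_group R[i] G1 := perfect_group_der1 G1_perfect.
have pG2 : perfect_group R[i] G2 := perfect_group_der1 G2_der1.
exists G1, G2; split; split.
- exact: G1_M24.
- exact: G2_M24.
- exact: PSL_perm_isog.
- by exists alt_mx_morphism; [exact: alt_mx_isom | exact: G2_isog].
- by [].
- by split; [exact: G1_selfnormal | exact: G2_selfnormal].
exists M24_exact.
exact: biperfect_bicrossproduct G1_selfnormal G2_selfnormal pG1 pG2.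
Qed.
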